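(* Let $a\in[\pi/3,2\pi/5)$ and put $$h_1(x):=\frac{6\pi^2}{(2\pi-5a)^2}\cos\frac{\pi\sqrt{10}\,(\pi-x)}{2\pi-5a},\qquad e_1(x):=\cos\frac{2\pi(2x-3a)}{2\pi-5a}+\cos\frac{\pi(2x-3a)}{2\pi-5a}.$$ Then the family $B_1=\{q_{\alpha,1}\}_{\alpha\in\mathbb{C}}$ constructed from $h_1$ and $e_1$ as described in the context consists of iso-bispectral potentials for the problems $\mathcal{L}_{1,0}(a,q)$ and $\mathcal{L}_{1,1}(a,q)$, i.e. for each $j\in\{0,1\}$ the spectrum of $\mathcal{L}_{1,j}(a,q_{\alpha,1})$ is the same for all $\alpha\in\mathbb{C}$. Thus, the spectra of $\mathcal{L}_{1,0}(a,q)$ and $\mathcal{L}_{1,1}(a,q)$ do not uniquely determine the potential $q$ in the class of complex-valued functions $q\in L_2(0,\pi)$ vanishing on $(0,a)$.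
   Context: For $\nu,j\in\{0,1\}$, $a\in(0,\pi)$ and a complex-valued $q\in L_2(0,\pi)$ with $q(x)=0$ on $(0,a)$, $\mathcal{L}_{\nu,j}(a,q)$ denotes the eigenvalue problem $$-y''(x)+q(x)y(x-a)=\lambda y(x),\quad 0<x<\pi,\qquad y^{(\nu)}(0)=y^{(j)}(\pi)=0.$$ (Since $q=0$ on $(0,a)$, the values of $y$ at negative arguments play no role.) Let $y_0(x,\lambda),y_1(x,\lambda)$ be the unique solutions of the equation with $y_\nu^{(j)}(0,\lambda)=\delta_{\nu,j}$ (Kronecker delta). The spectrum of $\mathcal{L}_{\nu,j}(a,q)$, with account of multiplicity, is the collection of zeros of the entire characteristic function $\Delta_{\nu,j}(\lambda)=y_{1-\nu}^{(j)}(\pi,\lambda)$. With $K_{h_1}(x)=\int_x^\pi h_1(\tau)\,d\tau$, for $\alpha\in\mathbb{C}$ the potential $q_{\alpha,1}$ on $(0,\pi)$ is $$q_{\alpha,1}(x)=\begin{cases}0, & x\in(0,\frac{3a}2)\cup(\pi-a,2a)\cup(\pi-\frac a2,\frac{5a}2),\\ \alpha e_1(x), & x\in(\frac{3a}2,\pi-a),\\ -\alpha K_{h_1}(x+\frac a2)\displaystyle\int_{3a/2}^{x-a/2}e_1(t)\,dt, & x\in(2a,\pi-\frac a2),\\ h_1(x), & x\in(\frac{5a}2,\pi).\end{cases}$$ (For $a=\pi/3$ the intervals $(\pi-a,2a)$ and $(\pi-a/2,5a/2)$ are empty.) *)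

(* Defs.v *)
From HB Require Import structures.
From mathcomp Require Import all_boot all_order all_algebra.
From mathcomp Require Import complex.
From mathcomp Require Import all_classical all_reals all_analysis.

Set Implicit Arguments.
Unset Strict Implicit.
Unset Printing Implicit Defensive.

Import Order.TTheory GRing.Theory Num.Theory.
Import numFieldNormedType.Exports.

Local Open Scope classical_set_scope.
Local Open Scope ring_scope.
Local Open Scope complex_scope.

(* R[i]-valued functions are integrated componentwise. *)

Definition cintegrable (R : realType) (D : set R) (f : R -> R[i]) : Prop :=
  (@lebesgue_measure R).-integrable D (EFin \o (fun x => complex.Re (f x))) /\
  (@lebesgue_measure R).-integrable D (EFin \o (fun x => complex.Im (f x))).

Definition cintegral (R : realType) (D : set R) (f : R -> R[i]) : R[i] :=
  (\int[@lebesgue_measure R]_(x in D) complex.Re (f x)) +i*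
  (\int[@lebesgue_measure R]_(x in D) complex.Im (f x)).

Definition L2_0pi (R : realType) (f : R -> R[i]) : Prop :=
  [/\ measurable_fun (`]0, pi[ : set R) (fun x => complex.Re (f x)),
      measurable_fun (`]0, pi[ : set R) (fun x => complex.Im (f x)) &
      (\int[@lebesgue_measure R]_(x in `]0%R, (pi : R)[)
         (complex.Re (f x) ^+ 2 + complex.Im (f x) ^+ 2)%:E < +oo)%E].

(* Elements of L_2 being classes modulo null sets, q vanishes a.e. on (0, a). *)
Definition potential (R : realType) (a : R) (q : R -> R[i]) : Prop :=
  L2_0pi q /\
  {ae @lebesgue_measure R, forall x, x \in `]0, a[ -> q x = 0}.

(* f is absolutely continuous on [0, pi], with (a.e.) derivative df. *)
Definition AC_with_derivative (R : realType) (f df : R -> R[i]) : Prop :=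
  cintegrable `[0, pi] df /\
  forall x : R, x \in `[0, pi] -> f x = f 0 + cintegral `[0, x] df.

(* In the sequel the indices 0 and 1 are encoded by false and true.          *)
(* A solution is given as Y, where Y 0 = y and Y 1 = y' (a continuous        *)
(* function, so that its values at 0 and pi are meaningful), y' being        *)
(* absolutely continuous and the equation holding a.e. on (0, pi).           *)
(* When q is a potential, values of y at negative arguments are multiplied   *)
(* by 0 for almost every x.                                                  *)
Definition solution (R : realType) (a : R) (q : R -> R[i]) (lambda : R[i])
    (Y : bool -> R -> R[i]) : Prop :=
  exists d2y : R -> R[i],
    [/\ AC_with_derivative (Y false) (Y true),
        AC_with_derivative (Y true) d2y &
        {ae @lebesgue_measure R, forall x, x \in `]0, pi[ ->
           - d2y x + q x * Y false (x - a) = lambda * Y false x}].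

Definition fundamental_solution (R : realType) (a : R) (q : R -> R[i])
    (lambda : R[i]) (nu : bool) (Y : bool -> R -> R[i]) : Prop :=
  solution a q lambda Y /\ forall j : bool, Y j 0 = (nu == j)%:R.

(* Delta_{nu,j}(lambda) = y_{1-nu}^{(j)}(pi, lambda).  The value is unique;   *)
(* the default 0 of xget plays no role, the solution y_{1-nu} always exists. *)
Definition characteristic_function (R : realType) (a : R) (q : R -> R[i])
    (nu j : bool) (lambda : R[i]) : R[i] :=
  xget 0 [set c | exists2 Y : bool -> R -> R[i],
                    fundamental_solution a q lambda (~~ nu) Y & c = Y j pi].

(* Complex differentiability: R[i]^o is normed over the field R[i]. *)
Definition entire (R : realType) (g : R[i]^o -> R[i]^o) : Prop :=
  forall z : R[i]^o, derivable g z 1.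

(* Multisets of complex numbers are encoded as sets of labelled copies:      *)
(* (z, k) belongs to zeros f when z is a zero of f of multiplicity > k,      *)
(* i.e. when (w - z)^(k+1) divides f(w) in the ring of entire functions.     *)
Definition zeros (R : realType) (f : R[i] -> R[i]) : set (R[i] * nat) :=
  [set p | exists2 g : R[i] -> R[i], entire g &
             forall w, f w = (w - p.1) ^+ p.2.+1 * g w].

Definition spectrum (R : realType) (a : R) (q : R -> R[i]) (nu j : bool) :
    set (R[i] * nat) :=
  zeros (characteristic_function a q nu j).

Definition K_ (R : realType) (h : R -> R) (x : R) : R :=
  \int[@lebesgue_measure R]_(t in `[x, pi]) h t.

Definition q_family (R : realType) (a : R) (h e : R -> R) (alpha : R[i])
    (x : R) : R[i] :=
  if 3 * a / 2 < x < pi - a then alpha * (e x)%:C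
  else if 2 * a < x < pi - a / 2 then
    - alpha * (K_ h (x + a / 2))%:C *
      (\int[@lebesgue_measure R]_(t in `[(3 * a / 2)%R, (x - a / 2)%R]) e t)%:C
  else if 5 * a / 2 < x < pi then (h x)%:C
  else 0.

Definition h1 (R : realType) (a x : R) : R :=
  6 * pi ^+ 2 / (2 * pi - 5 * a) ^+ 2 *
  cos (pi * Num.sqrt 10 * (pi - x) / (2 * pi - 5 * a)).

Definition e1 (R : realType) (a x : R) : R :=
  cos (2 * pi * (2 * x - 3 * a) / (2 * pi - 5 * a)) +
  cos (pi * (2 * x - 3 * a) / (2 * pi - 5 * a)).

Definition q1 (R : realType) (a : R) (alpha : R[i]) : R -> R[i] :=
  q_family a (h1 a) (e1 a) alpha.

(* Main.v *)
Require Import Defs.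
From mathcomp Require Import all_boot all_order all_algebra.
From mathcomp Require Import complex.
From mathcomp Require Import all_classical all_reals all_analysis.
From mathcomp Require Import measurable_realfun ring lra.

Set Implicit Arguments.
Unset Strict Implicit.
Unset Printing Implicit Defensive.

Import Order.TTheory GRing.Theory Num.Theory.
Import numFieldNormedType.Exports.

Local Open Scope classical_set_scope.
Local Open Scope ring_scope.
Local Open Scope complex_scope.

Local Notation Re := complex.Re.
Local Notation Im := complex.Im.


(** Both characteristic functions are values at pi of the solution y with
    y(0) = 1 and y'(0) = 0, so it is enough that y(pi) and y'(pi) are the same
    for all alpha.

    On [0, 3a/2] the potential vanishes and y = C, the solution of
    C'' = -lambda C with C(0) = 1, C'(0) = 0 ([initial_solution]).  Put
    b = pi - 5a/2; the potential lives on three windows of length b starting at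
    3a/2, 2a and 5a/2.  On the first two windows x - a < 3a/2, so there the
    delayed value y(x - a) is C(x - a), and replacing alpha by beta changes y by
    (beta - alpha) V, where V does not depend on alpha:
    V'' = -lambda V + f, with f = e(x) C(x - a) on the first window,
    f = - K(x + a/2) E(x - a/2) C(x - a) on the second one and
    f = h(x) V(x - a) on the third one ([correction_exists],
    [fundamental_solution_transfer]).  Here e = e1, h = h1, E is the primitive of
    e vanishing at the left end of the first window and K is the integral of h up
    to pi.  What has to be shown is V(pi) = V'(pi) = 0, or, by the Wronskian
    identity, that f is orthogonal to every phi with phi'' = -lambda phi.

    This is [responses_cancel].  Measure positions by the distance u from the
    left end of each window and write k for K on the third window.  The product
    formula 2 phi(x) C(y) = phi(x + y) + phi(x - y) and integrations by parts
    turn the three integrals into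
      int_0^b phi'(2a + 2w) (int_w^b k(u) E(u - w) du - E(w)) dw
        + 1/2 (phi(2a) - phi(a)) int_0^b k(u) E(u) du,
    which vanishes as soon as E is fixed by the integral operator
    E |-> int_w^b k(u) E(u - w) du, the second integral being the value of that
    identity at w = 0.  The functions h1 and e1 are tuned for this: E is the sum
    of two sine modes of frequencies pi/b and 2 pi/b, the operator maps a sine
    mode to a combination of its reflection in b/2 and of k
    ([truncated_convolution]), and since the square of the frequency of k,
    5/2 (pi/b)^2, is the mean of the squares of the two others, the two
    contributions of k cancel; what remains is E again ([envelope_data]).

    The cancellation is verified by differentiation: every integral above is
    represented by a primitive, the change of order of integration becomes
    [convolution_swap], and an antiderivative of the sum of the three integrands
    is displayed that vanishes at u = 0 and u = b.

    Finally q_0 and q_1 are potentials with the same spectra that differ on the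
    first quarter of the first window. *)

(** * Calculus of complex-valued functions of a real variable *)

Lemma cplx_ext (R : realType) (x y : R[i]) : Re x = Re y -> Im x = Im y -> x = y.
Proof. by case: x => a b; case: y => c d /= -> ->. Qed.

Lemma cReD (R : realType) (x y : R[i]) : Re (x + y) = Re x + Re y.
Proof. by case: x y => a b []. Qed.
Lemma cImD (R : realType) (x y : R[i]) : Im (x + y) = Im x + Im y.
Proof. by case: x y => a b []. Qed.
Lemma cReN (R : realType) (x : R[i]) : Re (- x) = - Re x.
Proof. by case: x. Qed.
Lemma cImN (R : realType) (x : R[i]) : Im (- x) = - Im x.
Proof. by case: x. Qed.
Lemma cReM (R : realType) (x y : R[i]) : Re (x * y) = Re x * Re y - Im x * Im y.
Proof. by case: x y => a b []. Qed.
Lemma cImM (R : realType) (x y : R[i]) : Im (x * y) = Re x * Im y + Im x * Re y.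
Proof. by case: x y => a b []. Qed.

(** Differentiation is componentwise and required on the whole line, so that no
    condition at the ends of an interval ever has to be carried along. *)
Definition cderive (R : realType) (f df : R -> R[i]) : Prop :=
  forall x : R, is_derive x 1 (fun t => Re (f t)) (Re (df x)) /\
                is_derive x 1 (fun t => Im (f t)) (Im (df x)).

Lemma cderive_eq (R : realType) (f df df' : R -> R[i]) :
  cderive f df -> (forall x, df x = df' x) -> cderive f df'.
Proof. by move=> h e x; rewrite -e. Qed.

Lemma cderive_ext (R : realType) (f f' df : R -> R[i]) :
  cderive f df -> (forall x, f x = f' x) -> cderive f' df.
Proof. by move=> h e; rewrite (_ : f' = f)//; apply/funext. Qed.

Lemma cderive_cst (R : realType) (c : R[i]) : cderive (fun=> c) (fun=> 0 : R[i]).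
Proof. by move=> x; split; exact: is_derive_cst. Qed.

Lemma cderiveD (R : realType) (f g df dg : R -> R[i]) :
  cderive f df -> cderive g dg ->
  cderive (fun x => f x + g x) (fun x => df x + dg x).
Proof.
move=> hf hg x; have [f1 f2] := hf x; have [g1 g2] := hg x.
split.
- rewrite (_ : (fun t => _) = (fun t => Re (f t)) + (fun t => Re (g t))).
    by rewrite cReD; exact: is_deriveD.
  by apply/funext => t; rewrite cReD.
- rewrite (_ : (fun t => _) = (fun t => Im (f t)) + (fun t => Im (g t))).
    by rewrite cImD; exact: is_deriveD.
  by apply/funext => t; rewrite cImD.
Qed.

Lemma cderiveN (R : realType) (f df : R -> R[i]) :
  cderive f df -> cderive (fun x => - f x) (fun x => - df x).
Proof.
move=> hf x; have [f1 f2] := hf x.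
split.
- rewrite (_ : (fun t => _) = - (fun t => Re (f t))).
    by rewrite cReN; exact: is_deriveN.
  by apply/funext => t; rewrite cReN.
- rewrite (_ : (fun t => _) = - (fun t => Im (f t))).
    by rewrite cImN; exact: is_deriveN.
  by apply/funext => t; rewrite cImN.
Qed.

Lemma cderiveM (R : realType) (f g df dg : R -> R[i]) :
  cderive f df -> cderive g dg ->
  cderive (fun x => f x * g x) (fun x => df x * g x + f x * dg x).
Proof.
move=> hf hg x; have [f1 f2] := hf x; have [g1 g2] := hg x.
split.
- rewrite (_ : (fun t => _) = (fun t => Re (f t)) * (fun t => Re (g t)) -
    (fun t => Im (f t)) * (fun t => Im (g t))).
    apply: (is_derive_eq (is_deriveB (is_deriveM f1 g1) (is_deriveM f2 g2))).
    rewrite cReD !cReM /GRing.scale /=; ring.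
  by apply/funext => t; rewrite cReM.
- rewrite (_ : (fun t => _) = (fun t => Re (f t)) * (fun t => Im (g t)) +
    (fun t => Im (f t)) * (fun t => Re (g t))).
    apply: (is_derive_eq (is_deriveD (is_deriveM f1 g2) (is_deriveM f2 g1))).
    rewrite cImD !cImM /GRing.scale /=; ring.
  by apply/funext => t; rewrite cImM.
Qed.

Lemma cderiveZ (R : realType) (c : R[i]) (f df : R -> R[i]) :
  cderive f df -> cderive (fun x => c * f x) (fun x => c * df x).
Proof.
move=> hf; apply: cderive_eq; first exact: cderiveM (cderive_cst c) hf.
by move=> x /=; rewrite mul0r add0r.
Qed.

Lemma cderive_comp_affine (R : realType) (f df : R -> R[i]) (p s : R) :
  cderive f df -> cderive (fun x => f (p + s * x)) (fun x => s%:C * df (p + s * x)).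
Proof.
move=> hf x; have [f1 f2] := hf (p + s * x).
have h : is_derive x 1 (fun t : R => p + s * t) s.
  rewrite (_ : (fun t => _) = cst p + s *: id).
    rewrite -[X in is_derive _ _ _ X](_ : 0 + s *: (1 : R) = s).
      exact: is_deriveD.
    by rewrite add0r /GRing.scale /= mulr1.
  by apply/funext.
split.
- rewrite cReM /= mul0r subr0 mulrC.
  exact: (@is_derive1_comp _ (fun t => Re (f t)) (fun t : R => p + s * t)).
- rewrite cImM /= mul0r addr0 mulrC.
  exact: (@is_derive1_comp _ (fun t => Im (f t)) (fun t : R => p + s * t)).
Qed.

Lemma cderive_shift (R : realType) (f df : R -> R[i]) (p : R) :
  cderive f df -> cderive (fun x => f (p + x)) (fun x => df (p + x)).
Proof.
move=> /(cderive_comp_affine p 1) hf.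
apply: cderive_ext (cderive_eq hf _) _ => x; rewrite ?rmorph1 ?mul1r//.
Qed.

Lemma cderive_shiftB (R : realType) (f df : R -> R[i]) (p : R) :
  cderive f df -> cderive (fun x => f (x - p)) (fun x => df (x - p)).
Proof.
move=> /(cderive_shift (- p)) hf.
by apply: cderive_ext (cderive_eq hf _) _ => x; rewrite addrC.
Qed.

Lemma cderive_reflect (R : realType) (f df : R -> R[i]) (p : R) :
  cderive f df -> cderive (fun x => f (p - x)) (fun x => - df (p - x)).
Proof.
move=> /(cderive_comp_affine p (-1)) hf.
apply: cderive_ext (cderive_eq hf _) _ => x; rewrite ?rmorphN1 ?mulN1r//.
Qed.

Lemma cderive_double (R : realType) (f df : R -> R[i]) (p : R) :
  cderive f df -> cderive (fun x => f (p + 2 * x)) (fun x => 2 * df (p + 2 * x)).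
Proof.
by move=> /(cderive_comp_affine p 2) hf; apply: cderive_eq hf _ => x;
  rewrite rmorph_nat.
Qed.

Lemma cderive_real (R : realType) (f df : R -> R) :
  (forall x : R, is_derive x 1 f (df x)) ->
  cderive (fun x => (f x)%:C) (fun x => (df x)%:C).
Proof. by move=> h x; split; [exact: h | exact: is_derive_cst]. Qed.

Lemma cderive_continuous (R : realType) (f df : R -> R[i]) : cderive f df ->
  continuous (fun x => Re (f x)) /\ continuous (fun x => Im (f x)).
Proof.
move=> hf; split=> x; have [f1 f2] := hf x.
  by apply/differentiable_continuous/derivable1_diffP.
by apply/differentiable_continuous/derivable1_diffP.
Qed.

(** By the mean value theorem; the derivative is controlled on an interval only,
    as the differential equation of a solution is. *)
Lemma derive0_constant (R : realType) (f df : R -> R) (l m : R) :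
  (forall x : R, is_derive x 1 f (df x)) -> (forall x, l <= x <= m -> df x = 0) ->
  forall x y, l <= x <= m -> l <= y <= m -> f x = f y.
Proof.
move=> hf h0 x y; wlog xy : x y / x <= y.
  by move=> H xm ym; case: (leP x y) => [/H|/ltW /H] -> //.
move=> /andP[lx _] /andP[_ ym].
have [|c /[!in_itv]/= /andP[xc cy]] := MVT_segment xy (fun y _ => hf y).
  by apply: derivable_within_continuous => z _; exact: ex_derive.
rewrite h0 ?(le_trans lx)//= ?(le_trans cy)// mul0r => /eqP.
by rewrite subr_eq0 => /eqP.
Qed.

Lemma cderive0_constant (R : realType) (f df : R -> R[i]) (l m : R) :
  cderive f df -> (forall x, l <= x <= m -> df x = 0) ->
  forall x y, l <= x <= m -> l <= y <= m -> f x = f y.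
Proof.
move=> hf h0 x y xm ym; apply: cplx_ext.
  apply: (@derive0_constant _ (fun t => Re (f t)) (fun t => Re (df t)) l m) => //.
    by move=> t; have [] := hf t.
  by move=> t /h0 ->.
apply: (@derive0_constant _ (fun t => Im (f t)) (fun t => Im (df t)) l m) => //.
  by move=> t; have [] := hf t.
by move=> t /h0 ->.
Qed.

Lemma cderive0_constantT (R : realType) (f df : R -> R[i]) :
  cderive f df -> (forall x, df x = 0) -> forall x y, f x = f y.
Proof.
move=> hf h0 x y.
apply: (cderive0_constant (l := Num.min x y) (m := Num.max x y) hf) => //.
  by rewrite ge_min lexx le_max lexx.
by rewrite ge_min lexx orbT le_max lexx orbT.
Qed.

(** The fundamental theorem for integrals with a variable upper limit says
    nothing to the left of the lower limit; the oriented integral from 0 is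
    therefore compared, near each x, with an integral started far enough to the
    left. *)
Lemma continuous_primitive (R : realType) (f : R -> R) : continuous f ->
  exists2 F : R -> R, F 0 = 0 & forall x : R, is_derive x 1 F (f x).
Proof.
move=> cf.
have cfi (u v : R) : (@lebesgue_measure R).-integrable `[u, v] (EFin \o f).
  apply: continuous_compact_integrable; first exact: segment_compact.
  exact: continuous_subspaceT.
pose G (m x : R) := \int[@lebesgue_measure R]_(t in `[m, x]) f t.
have GE (m m' x : R) : m <= m' -> m' <= x -> G m x - G m m' = G m' x.
  move=> mm' m'x; rewrite /G (@Rintegral_itvB _ f (BLeft m) (BRight x) m')//.
  by rewrite Rintegral_itv_obnd_cbnd//; apply: integrableS (cfi m' x) => //;
    apply: subset_itvr; rewrite bnd_simp.
pose F x := if 0 <= x then G 0 x else - G x 0.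
have FE (m x : R) : m <= 0 -> m <= x -> F x = G m x - G m 0.
  move=> m0 mx; rewrite /F; case: ifPn => x0.
    by rewrite GE.
  by rewrite -opprB GE// ltW// ltNge.
exists F; first by rewrite /F lexx /G set_itv1 Rintegral_set1.
move=> x.
pose m := - `|x| - 1.
have mx : m < x by rewrite /m; have := ler_norm (- x); rewrite normrN; lra.
have m0 : m < 0 by rewrite /m; have := normr_ge0 x; lra.
have [dG GE'] := @continuous_FTC1_closed _ f m x (x + 1) ltac:(lra) (cfi m (x + 1)) mx (cf x).
have hG : is_derive x 1 (fun t => G m t) (f x).
  by apply: DeriveDef; [exact: dG | rewrite -derive1E; exact: GE'].
have hG2 : is_derive x 1 (fun t => G m t - G m 0) (f x).
  rewrite (_ : (fun t => _) = (fun t => G m t) - cst (G m 0)).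
    by rewrite -[f x]subr0; exact: is_deriveB hG (is_derive_cst _ _ _).
  by apply/funext.
apply: near_eq_is_derive hG2; near=> y.
rewrite (FE m) ?(ltW m0)//; apply/ltW; near: y; exact: lt_nbhsr.
Unshelve. all: by end_near. Qed.

Lemma continuous_cprimitive (R : realType) (f : R -> R[i]) (p : R) :
  continuous (fun x => Re (f x)) -> continuous (fun x => Im (f x)) ->
  exists2 F : R -> R[i], F p = 0 & cderive F f.
Proof.
move=> /continuous_primitive[F1 _ d1] /continuous_primitive[F2 _ d2].
have dF : cderive (fun x => F1 x +i* F2 x) f.
  by move=> x; split; [exact: d1 | exact: d2].
exists (fun x => (F1 x +i* F2 x) - (F1 p +i* F2 p)); first by rewrite subrr.
apply: cderive_eq; first exact: cderiveD dF (cderive_cst _).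
by move=> x /=; rewrite addr0.
Qed.

Lemma cderive_primitive (R : realType) (f df : R -> R[i]) (p : R) :
  cderive f df -> exists2 F : R -> R[i], F p = 0 & cderive F f.
Proof. by move=> /cderive_continuous[]; exact: continuous_cprimitive. Qed.

(** * The equation without potential *)

Definition free_solution (R : realType) (lambda : R[i]) (phi psi : R -> R[i]) :=
  cderive phi psi /\ cderive psi (fun x => - lambda * phi x).

(** With rho^2 = lambda these are cos(rho x) and sin(rho x) / rho.  They are
    described by equations so that lambda = 0 is not a special case. *)
Definition cosine_sine (R : realType) (lambda : R[i]) (C S : R -> R[i]) : Prop :=
  [/\ cderive C (fun x => - lambda * S x), cderive S C, C 0 = 1 & S 0 = 0].

Lemma cosine_free (R : realType) (lambda : R[i]) (C S : R -> R[i]) :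
  cosine_sine lambda C S -> free_solution lambda C (fun x => - lambda * S x).
Proof. by case=> dC dS _ _; split => //; exact: cderiveZ. Qed.

Lemma sine_free (R : realType) (lambda : R[i]) (C S : R -> R[i]) :
  cosine_sine lambda C S -> free_solution lambda S C.
Proof. by case. Qed.

(** exp(mu x) is exp(Re mu x) (cos(Im mu x) + i sin(Im mu x)). *)
Lemma cexp_exists (R : realType) (mu : R[i]) :
  exists2 E : R -> R[i], E 0 = 1 & cderive E (fun x => mu * E x).
Proof.
have [i ii iE] : exists2 i : R[i],
    i * i = -1 & forall z : R[i], z = (Re z)%:C + i * (Im z)%:C.
  by exists (0 +i* 1); [exact: (sqr_i R) | exact: complexE].
pose e x : R[i] := (expR x)%:C; pose c x : R[i] := (cos x)%:C.
pose n x : R[i] := (sin x)%:C.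
have de : cderive e e by apply: cderive_real => x; exact: is_derive_expR.
have dc : cderive c (fun x => - n x).
  apply: cderive_eq; first by apply: cderive_real => x; exact: is_derive_cos.
  by move=> x; apply: cplx_ext; rewrite //= oppr0.
have dn : cderive n c by apply: cderive_real => x; exact: is_derive_sin.
exists (fun x => e (0 + Re mu * x) * (c (0 + Im mu * x) + i * n (0 + Im mu * x))).
  by rewrite !mulr0 !addr0 /e /c /n expR0 cos0 sin0 mulr0 addr0 mulr1.
have dE := cderive_comp_affine 0 (Re mu) de.
have dC := cderive_comp_affine 0 (Im mu) dc.
have dN := cderive_comp_affine 0 (Im mu) dn.
apply: cderive_eq; first exact: cderiveM dE (cderiveD dC (cderiveZ i dN)).
move=> x /=; set p := 0 + Re mu * x; set q := 0 + Im mu * x.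
rewrite [in RHS](iE mu).
move: (e _) (c _) (n _) (Re mu)%:C (Im mu)%:C => E C N u v.
transitivity (E * u * (C + i * N) + E * v * (i * C + (-1) * N)); first by ring.
by rewrite -ii; ring.
Qed.

(** From the exponentials exp(mu x) and exp(- mu x) with mu^2 = - lambda, except
    for lambda = 0 where they are the constant 1 and the identity. *)
Lemma cosine_sine_exists (R : realType) (lambda : R[i]) :
  exists C S, @cosine_sine R lambda C S.
Proof.
have [->|l0] := eqVneq lambda 0.
  exists (fun=> 1), (fun x => x%:C); split => //.
    by apply: cderive_eq; [exact: cderive_cst | move=> x; rewrite oppr0 mul0r].
  by apply: (@cderive_real _ id (fun=> 1)) => x; exact: is_derive_id.
pose mu := sqrtc (- lambda).
have mu2 : mu * mu = - lambda by rewrite -expr2 sqr_sqrtc.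
have mu0 : mu != 0 by rewrite sqrtc_eq0 oppr_eq0.
have [E E0 dE] := cexp_exists mu; have [F F0 dF] := cexp_exists (- mu).
exists (fun x => 2^-1 * (E x + F x)), (fun x => (2 * mu)^-1 * (E x + - F x)).
split.
- apply: cderive_eq; first by apply: cderiveZ; exact: cderiveD dE dF.
  by move=> x /=; rewrite -mu2; field.
- apply: cderive_eq; first by apply: cderiveZ; apply: cderiveD dE (cderiveN dF).
  by move=> x /=; field.
- by rewrite E0 F0; field.
- by rewrite E0 F0 subrr mulr0.
Qed.

Lemma cosine_sine_sqr (R : realType) (lambda : R[i]) (C S : R -> R[i]) (x : R) :
  cosine_sine lambda C S -> C x * C x + lambda * (S x * S x) = 1.
Proof.
move=> [dC dS C0 S0].
have d := cderiveD (cderiveM dC dC) (cderiveZ lambda (cderiveM dS dS)).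
have := cderive0_constantT d _ x 0 => /= ->; first by rewrite C0 S0; ring.
by move=> y; ring.
Qed.

(** The combinations D C + lambda X S and D S - X C have derivative 0 on the
    interval and vanish at [p]; they determine X and D because
    C^2 + lambda S^2 = 1. *)
Lemma harmonic_zero (R : realType) (lambda : R[i]) (X dX D dD : R -> R[i]) (l m p : R) :
  cderive X dX -> cderive D dD -> l <= p <= m -> X p = 0 -> D p = 0 ->
  (forall x, l <= x <= m -> dX x = D x /\ dD x = - lambda * X x) ->
  forall x, l <= x <= m -> X x = 0 /\ D x = 0.
Proof.
move=> hX hD pm Xp Dp H x xm.
have [C [S CS]] := cosine_sine_exists lambda.
have [dC dS _ _] := CS; have sq := cosine_sine_sqr x CS.
have d1 := cderiveD (cderiveM hD dC) (cderiveZ lambda (cderiveM hX dS)).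
have d2 := cderiveD (cderiveM hD dS) (cderiveN (cderiveM hX dC)).
have := cderive0_constant (l := l) (m := m) d1.
move=> /(_ _ x p) /= E1; have {E1} : D x * C x + lambda * (X x * S x) = 0.
  by rewrite E1// ?Dp ?Xp; [ring | move=> y /H[-> ->]; ring].
have := cderive0_constant (l := l) (m := m) d2.
move=> /(_ _ x p) /= E2; have {E2} : D x * S x - X x * C x = 0.
  by rewrite E2// ?Dp ?Xp; [ring | move=> y /H[-> ->]; ring].
move=> E2 E1; split.
  rewrite -[X x]mulr1 -sq.
  transitivity (- C x * (D x * S x - X x * C x) + S x * (D x * C x + lambda * (X x * S x))).
    by ring.
  by rewrite E1 E2; ring.
rewrite -[D x]mulr1 -sq.
transitivity (lambda * S x * (D x * S x - X x * C x) + C x * (D x * C x + lambda * (X x * S x))).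
  by ring.
by rewrite E1 E2; ring.
Qed.

(** Both sides solve the same initial value problem in [y]. *)
Lemma free_solution_add (R : realType) (lambda : R[i]) (C S phi psi : R -> R[i]) (x y : R) :
  cosine_sine lambda C S -> free_solution lambda phi psi ->
  phi (x + y) = phi x * C y + psi x * S y /\
  psi (x + y) = psi x * C y - lambda * phi x * S y.
Proof.
move=> [dC dS C0 S0] [dphi dpsi].
have dX := cderiveD (cderive_shift x dphi)
  (cderiveN (cderiveD (cderiveZ (phi x) dC) (cderiveZ (psi x) dS))).
have dD := cderiveD (cderive_shift x dpsi)
  (cderiveN (cderiveD (cderiveZ (psi x) dC) (cderiveZ (- lambda * phi x) dS))).
have := @harmonic_zero _ lambda _ _ _ _ (- `|y|) `|y| 0 dX dD.
rewrite /= oppr_le0 normr_ge0 addr0 C0 S0.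
move=> /(_ isT) /(_ ltac:(ring)) /(_ ltac:(ring)) /(_ _ y) [].
- by move=> z _; split; ring.
- by rewrite lerNnormlW ?ler_norm// ?lexx.
by move=> /eqP + /eqP; rewrite !subr_eq0 => /eqP -> /eqP ->; split; ring.
Qed.

(** * Forced equations and convolutions *)

Lemma cosine_sineN (R : realType) (lambda : R[i]) (C S : R -> R[i]) (x : R) :
  cosine_sine lambda C S -> C (- x) = C x /\ S (- x) = - S x.
Proof.
move=> CS; have [_ _ C0 S0] := CS; have sq := cosine_sine_sqr x CS.
have [] := free_solution_add x (- x) CS (sine_free CS).
rewrite subrr C0 S0 => e1 e2; split.
  rewrite -[C (- x)]mulr1 -sq.
  transitivity (C x * (C x * C (- x) - lambda * S x * S (- x)) +
    lambda * S x * (S x * C (- x) + C x * S (- x))); first by ring.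
  by rewrite -e1 -e2; ring.
rewrite -[S (- x)]mulr1 -sq.
transitivity (C x * (S x * C (- x) + C x * S (- x)) -
  S x * (C x * C (- x) - lambda * S x * S (- x))); first by ring.
by rewrite -e1 -e2; ring.
Qed.

Lemma free_solution_sub (R : realType) (lambda : R[i]) (C S phi psi : R -> R[i]) (x y : R) :
  cosine_sine lambda C S -> free_solution lambda phi psi ->
  phi (x - y) = phi x * C y - psi x * S y /\
  psi (x - y) = psi x * C y + lambda * phi x * S y.
Proof.
move=> CS F; have [-> ->] := free_solution_add x (- y) CS F.
by have [-> ->] := cosine_sineN y CS; split; ring.
Qed.

(** The solution of W'' = - lambda W + g at rest at [p], with its derivative. *)
Definition response (R : realType) (lambda : R[i]) (g : R -> R[i]) (p : R)
    (W dW : R -> R[i]) : Prop :=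
  [/\ cderive W dW, cderive dW (fun x => - lambda * W x + g x), W p = 0 & dW p = 0].

(** Variation of parameters. *)
Lemma response_exists (R : realType) (lambda : R[i]) (g dg : R -> R[i]) (p : R) :
  cderive g dg -> exists W dW, response lambda g p W dW.
Proof.
move=> hg; have [C [S CS]] := cosine_sine_exists lambda.
have [dC dS _ _] := CS.
have [A Ap dA] := cderive_primitive p (cderiveM hg dC).
have [B Bp dB] := cderive_primitive p (cderiveM hg dS).
exists (fun x => S x * A x - C x * B x), (fun x => C x * A x + lambda * (S x * B x)).
split.
- apply: cderive_eq; first exact: cderiveD (cderiveM dS dA) (cderiveN (cderiveM dC dB)).
  by move=> x /=; ring.
- apply: cderive_eq; first exact: cderiveD (cderiveM dC dA) (cderiveZ lambda (cderiveM dS dB)).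
  move=> x /=; rewrite -[g x in RHS]mulr1 -(cosine_sine_sqr x CS); ring.
- by rewrite Ap Bp; ring.
- by rewrite Ap Bp; ring.
Qed.

(** Hence the integral of [phi * g] over an interval is read off from the values
    of [W] and [dW] at its ends. *)
Lemma wronskian_derive (R : realType) (lambda : R[i]) (phi psi g W dW : R -> R[i]) (p : R) :
  free_solution lambda phi psi -> response lambda g p W dW ->
  cderive (fun x => phi x * dW x - psi x * W x) (fun x => phi x * g x).
Proof.
move=> [dphi dpsi] [hW hdW _ _]; apply: cderive_eq.
  exact: cderiveD (cderiveM dphi hdW) (cderiveN (cderiveM dpsi hW)).
by move=> x /=; ring.
Qed.

(** Both sides are the convolution int_0^u s(t) psi(p + 2 (u - t)) dt.  On the
    left psi is expanded at p + 2u by its addition formula, which gives moments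
    of [s]; on the right s(u - t) is expanded, after exchanging the roles of the
    two factors, which gives moments of [psi].  The two sides correspond to the
    two ends of the interval of integration: the integral up to w in the first
    form plus the integral up to u - w in the second form does not depend on
    w. *)
Lemma convolution_swap (R : realType) (kappa lambda : R[i])
    (C S c s phi psi al be rc rs : R -> R[i]) (p : R) :
  cosine_sine lambda C S -> cosine_sine kappa c s -> free_solution lambda phi psi ->
  cderive al (fun u => s u * C (2 * u)) -> al 0 = 0 ->
  cderive be (fun u => s u * S (2 * u)) -> be 0 = 0 ->
  cderive rc (fun u => c u * psi (p + 2 * u)) -> rc 0 = 0 ->
  cderive rs (fun u => s u * psi (p + 2 * u)) -> rs 0 = 0 ->
  forall u, psi (p + 2 * u) * al u + lambda * phi (p + 2 * u) * be u =
            s u * rc u - c u * rs u.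
Proof.
move=> CS cs F dal al0 dbe be0 drc rc0 drs rs0 u.
pose x := p + 2 * u.
have d := cderiveD (cderiveD (cderiveZ (psi x) dal) (cderiveZ (lambda * phi x) dbe))
  (cderiveD (cderiveZ (s u) (cderive_reflect u drc))
            (cderiveN (cderiveZ (c u) (cderive_reflect u drs)))).
have := cderive0_constantT d _ u 0.
rewrite /= subrr subr0 al0 be0 rc0 rs0 !mulr0 oppr0 !addr0 !add0r; apply=> w.
rewrite (_ : p + 2 * (u - w) = x - 2 * w); last by rewrite /x; ring.
have [_ ->] := free_solution_sub x (2 * w) CS F.
have -> : s w = s u * c (u - w) - c u * s (u - w).
  have [-> _] := free_solution_sub u w cs (sine_free cs).
  have [-> _] := free_solution_sub u w cs (cosine_free cs).
  by rewrite -[s w in LHS]mulr1 -(cosine_sine_sqr u cs); ring.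
by ring.
Qed.

(** The left-hand side is int_w^b k(u) s(u - w) du.  It satisfies
    G'' = - kappa G + k and is at rest at [b]; so is the right-hand side, because
    k'' = - gamma k. *)
Lemma truncated_convolution (R : realType) (kappa gamma h0 : R[i])
    (c s k h Pc Ps : R -> R[i]) (b : R) :
  cosine_sine kappa c s -> cderive k (fun u => - h u) -> cderive h (fun u => gamma * k u) ->
  k b = 0 -> h b = h0 -> kappa - gamma != 0 ->
  cderive Ps (fun u => - (k u * s u)) -> Ps b = 0 ->
  cderive Pc (fun u => - (k u * c u)) -> Pc b = 0 ->
  forall w, Ps w * c w - Pc w * s w = (kappa - gamma)^-1 * (k w - h0 * s (b - w)).
Proof.
move=> cs dk dh kb hb n0 dPs Psb dPc Pcb w.
have [dc ds c0 s0] := cs.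
have dX := cderiveD (cderiveD (cderiveM dPs dc) (cderiveN (cderiveM dPc ds)))
  (cderiveN (cderiveZ (kappa - gamma)^-1
     (cderiveD dk (cderiveN (cderiveZ h0 (cderive_reflect b ds)))))).
have dD := cderiveD (cderiveN (cderiveD (cderiveZ kappa (cderiveM dPs ds)) (cderiveM dPc dc)))
  (cderiveZ (kappa - gamma)^-1
     (cderiveD dh (cderiveN (cderiveZ h0 (cderive_reflect b dc))))).
have := @harmonic_zero _ kappa _ _ _ _ (Num.min w b) (Num.max w b) b dX dD.
rewrite /= subrr Psb Pcb kb hb c0 s0 ge_min lexx orbT le_max lexx orbT.
move=> /(_ isT) /(_ ltac:(ring)) /(_ ltac:(ring)) /(_ _ w) [].
- move=> z _; split; first by ring.
  transitivity (k z * (c z * c z + kappa * (s z * s z))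
      - kappa * (Ps z * c z - Pc z * s z)
      + (kappa - gamma)^-1 * (gamma * k z - h0 * kappa * s (b - z))).
    by ring.
  by rewrite (cosine_sine_sqr z cs); field.
- by rewrite ge_min lexx le_max lexx.
by move=> /eqP; rewrite subr_eq0 => /eqP.
Qed.

(** * Orthogonality of the forcing to free solutions *)

(** Repeated use reduces an identity modulo hypotheses to a ring identity: the
    coefficients [c] express the difference of the two sides as a combination of
    the differences of the sides of the hypotheses. *)
Lemma eq_by_multiple (K : comPzRingType) (c l r x y : K) :
  l = r -> x + c * r = y + c * l -> x = y.
Proof. by move=> -> /addIr. Qed.

(** The claim is W(p + u) = int_0^u E(t) C(u - 2t - a) dt: an integration by parts
    removes from Duhamel's formula the derivative [e] of [E], and the addition
    formula then leaves only the two moments [al] and [be] of [E]. *)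
Lemma first_response (R : realType) (lambda : R[i]) (C S E e al be W dW : R -> R[i])
    (a p : R) :
  cosine_sine lambda C S -> cderive E e -> E 0 = 0 ->
  cderive al (fun u => E u * C (2 * u)) -> al 0 = 0 ->
  cderive be (fun u => E u * S (2 * u)) -> be 0 = 0 ->
  response lambda (fun x => e (x - p) * C (x - p + a)) p W dW ->
  forall u, W (p + u) = C (u - a) * al u + lambda * S (u - a) * be u /\
    dW (p + u) = - lambda * S (u - a) * al u + lambda * C (u - a) * be u
                 + E u * C (a + u).
Proof.
move=> CS dE E0 dal al0 dbe be0 [hW hdW Wp dWp] u.
have [dC dS C0 S0] := CS.
have dCa := cderive_shiftB a dC; have dSa := cderive_shiftB a dS.
have dX := cderiveD (cderive_shift p hW) (cderiveN
  (cderiveD (cderiveM dCa dal) (cderiveM (cderiveZ lambda dSa) dbe))).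
have dD := cderiveD (cderive_shift p hdW) (cderiveN
  (cderiveD (cderiveD (cderiveM (cderiveZ (- lambda) dSa) dal)
                      (cderiveM (cderiveZ lambda dCa) dbe))
            (cderiveM dE (cderive_shift a dC)))).
have := @harmonic_zero _ lambda _ _ _ _ (Num.min u 0) (Num.max u 0) 0 dX dD.
rewrite /= addr0 Wp dWp al0 be0 E0 ge_min lexx orbT le_max lexx orbT.
move=> /(_ isT) /(_ ltac:(ring)) /(_ ltac:(ring)) /(_ _ u) [].
- move=> z _.
  rewrite (_ : p + z - p = z); last by ring.
  rewrite (_ : a + z = 2 * z - (z - a)); last by ring.
  rewrite (_ : z + a = 2 * z - (z - a)); last by ring.
  have [-> _] := free_solution_sub (2 * z) (z - a) CS (cosine_free CS).
  have [-> _] := free_solution_sub (2 * z) (z - a) CS (sine_free CS).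
  by split; ring.
- by rewrite ge_min lexx le_max lexx.
by move=> /eqP + /eqP; rewrite !subr_eq0 => /eqP -> /eqP ->.
Qed.

(** The left-hand side is the sum over the three windows of the integrals of the
    forcing against [phi], by [wronskian_derive].  The hypotheses on the modes and
    on [k] make s1 + s2 a fixed point of E |-> int_w^b k(u) E(u - w) du (fact [G]
    below), which annihilates that sum. *)
Lemma responses_cancel (R : realType) (lambda kappa1 kappa2 gamma h0 : R[i])
    (C S c1 s1 c2 s2 k h phi psi W1 dW1 W2 dW2 W3 dW3 : R -> R[i]) (a b : R) :
  cosine_sine lambda C S -> cosine_sine kappa1 c1 s1 -> cosine_sine kappa2 c2 s2 ->
  s1 b + s2 b = 0 -> (forall w, s1 (b - w) - s2 (b - w) = s1 w + s2 w) ->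
  cderive k (fun u => - h u) -> cderive h (fun u => gamma * k u) ->
  k b = 0 -> h b = h0 -> h0 != 0 ->
  kappa1 - gamma = - h0 -> kappa2 - gamma = h0 ->
  response lambda (fun x => (c1 (x - 3 * a / 2) + c2 (x - 3 * a / 2)) * C (x - a))
    (3 * a / 2) W1 dW1 ->
  response lambda
    (fun x => - k (x - 2 * a) * (s1 (x - 2 * a) + s2 (x - 2 * a)) * C (x - a))
    (2 * a) W2 dW2 ->
  response lambda (fun x => h (x - 5 * a / 2) * W1 (x - a)) (5 * a / 2) W3 dW3 ->
  free_solution lambda phi psi ->
  (phi (3 * a / 2 + b) * dW1 (3 * a / 2 + b) - psi (3 * a / 2 + b) * W1 (3 * a / 2 + b))
  + (phi (2 * a + b) * dW2 (2 * a + b) - psi (2 * a + b) * W2 (2 * a + b))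
  + (phi (5 * a / 2 + b) * dW3 (5 * a / 2 + b) - psi (5 * a / 2 + b) * W3 (5 * a / 2 + b))
  = 0.
Proof.
move=> CS cs1 cs2 Eb Erefl dk dh kb hb hn0 k1 k2 r1 r2 r3 F.
have [dC dS C0 S0] := CS; have [dphi dpsi] := F.
have [dc1 ds1 c10 s10] := cs1; have [dc2 ds2 c20 s20] := cs2.
have dCd : cderive (fun u => C (2 * u)) (fun u => 2 * (- lambda * S (2 * u))).
  by apply: cderive_ext (cderive_eq (cderive_double 0 dC) _) _ => x; rewrite add0r.
have dSd : cderive (fun u => S (2 * u)) (fun u => 2 * C (2 * u)).
  by apply: cderive_ext (cderive_eq (cderive_double 0 dS) _) _ => x; rewrite add0r.
have dpd := cderive_double (2 * a) dpsi.
(* Moments of the modes against C(2u), S(2u), which describe W1, and against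
   phi'(2a + 2u). *)
have [al1 al10 dal1] := cderive_primitive 0 (cderiveM ds1 dCd).
have [be1 be10 dbe1] := cderive_primitive 0 (cderiveM ds1 dSd).
have [al2 al20 dal2] := cderive_primitive 0 (cderiveM ds2 dCd).
have [be2 be20 dbe2] := cderive_primitive 0 (cderiveM ds2 dSd).
have [rc1 rc10 drc1] := cderive_primitive 0 (cderiveM dc1 dpd).
have [rs1 rs10 drs1] := cderive_primitive 0 (cderiveM ds1 dpd).
have [rc2 rc20 drc2] := cderive_primitive 0 (cderiveM dc2 dpd).
have [rs2 rs20 drs2] := cderive_primitive 0 (cderiveM ds2 dpd).
(* Moments of the modes against k over [u, b]. *)
have [Pc1 Pc1b dPc1] := cderive_primitive b (cderiveN (cderiveM dk dc1)).
have [Ps1 Ps1b dPs1] := cderive_primitive b (cderiveN (cderiveM dk ds1)).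
have [Pc2 Pc2b dPc2] := cderive_primitive b (cderiveN (cderiveM dk dc2)).
have [Ps2 Ps2b dPs2] := cderive_primitive b (cderiveN (cderiveM dk ds2)).
have conv1 := convolution_swap CS cs1 F dal1 al10 dbe1 be10 drc1 rc10 drs1 rs10.
have conv2 := convolution_swap CS cs2 F dal2 al20 dbe2 be20 drc2 rc20 drs2 rs20.
have n1 : kappa1 - gamma != 0 by rewrite k1 oppr_eq0.
have n2 : kappa2 - gamma != 0 by rewrite k2.
have G1 := truncated_convolution cs1 dk dh kb hb n1 dPs1 Ps1b dPc1 Pc1b.
have G2 := truncated_convolution cs2 dk dh kb hb n2 dPs2 Ps2b dPc2 Pc2b.
have G w : (Ps1 w * c1 w - Pc1 w * s1 w) + (Ps2 w * c2 w - Pc2 w * s2 w) = s1 w + s2 w.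
  by rewrite G1 G2 k1 k2 -Erefl; field.
have W1E u : W1 (3 * a / 2 + u) = C (u - a / 2) * (al1 u + al2 u)
      + lambda * S (u - a / 2) * (be1 u + be2 u) /\
    dW1 (3 * a / 2 + u) = - lambda * S (u - a / 2) * (al1 u + al2 u)
      + lambda * C (u - a / 2) * (be1 u + be2 u) + (s1 u + s2 u) * C (a / 2 + u).
  apply: (@first_response _ lambda C S (fun u => s1 u + s2 u) (fun u => c1 u + c2 u)
    (fun u => al1 u + al2 u) (fun u => be1 u + be2 u) W1 dW1 (a / 2) (3 * a / 2)) => //.
  - exact: cderiveD.
  - by rewrite s10 s20 addr0.
  - by apply: cderive_eq (cderiveD dal1 dal2) _ => x /=; ring.
  - by rewrite al10 al20 addr0.
  - by apply: cderive_eq (cderiveD dbe1 dbe2) _ => x /=; ring.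
  - by rewrite be10 be20 addr0.
  have [rW rdW ? ?] := r1; split => //; apply: cderive_eq rdW _ => x /=.
  by rewrite (_ : x - 3 * a / 2 + a / 2 = x - a)//; field.
have dT := cderiveD (cderiveD (cderive_shift (3 * a / 2) (wronskian_derive F r1))
  (cderive_shift (2 * a) (wronskian_derive F r2)))
  (cderive_shift (5 * a / 2) (wronskian_derive F r3)).
have [rW rdW W10 dW10] := r1.
(* The antiderivative: d1 and d2 are the boundary terms of the integrations by
   parts on the first and third windows; d3 turns the convolution of E with
   phi'(2a + 2u), integrated against k, into the integral of phi'(2a + 2u) E; d4
   is the multiple of int k E left over by the product formula. *)
have d1 := cderiveM (cderiveM (cderiveD ds1 ds2) (cderive_shift (3 * a / 2) dphi))
  (cderive_shift (a / 2) dC).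
have d2 := cderiveN (cderiveM (cderiveM dk (cderive_shift (5 * a / 2) dphi))
  (cderive_shift (3 * a / 2) rW)).
have d3 := cderiveN (cderiveD
  (cderiveD (cderiveM drc1 dPs1) (cderiveN (cderiveM drs1 dPc1)))
  (cderiveD (cderiveM drc2 dPs2) (cderiveN (cderiveM drs2 dPc2)))).
have d4 := cderiveZ (- (2^-1 * (phi (2 * a) - phi a))) (cderiveD dPs1 dPs2).
have dZ := cderiveD dT (cderiveN (cderiveD (cderiveD d1 d2) (cderiveD d3 d4))).
match type of dZ with cderive _ ?d => have dZ0 : forall u, d u = 0 end.
  move=> u /=.
  have [-> ->] := W1E u.
  rewrite (_ : 3 * a / 2 + u - 3 * a / 2 = u); last by field.
  rewrite (_ : 2 * a + u - 2 * a = u); last by field.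
  rewrite (_ : 5 * a / 2 + u - 5 * a / 2 = u); last by field.
  rewrite (_ : 3 * a / 2 + u - a = a / 2 + u); last by field.
  rewrite (_ : 2 * a + u - a = a + u); last by field.
  rewrite (_ : 5 * a / 2 + u - a = 3 * a / 2 + u); last by field.
  have [-> _] := W1E u.
  have shift1 : psi (3 * a / 2 + u) * C (a / 2 + u)
      - lambda * phi (3 * a / 2 + u) * S (a / 2 + u) = psi (2 * a + 2 * u).
    have [_ <-] := free_solution_add (3 * a / 2 + u) (a / 2 + u) CS F.
    by congr psi; field.
  have shift2 : phi (2 * a + u) * C (a + u) = 2^-1 * (phi (3 * a + 2 * u) + phi a).
    rewrite (_ : 3 * a + 2 * u = (2 * a + u) + (a + u)); last by field.
    rewrite [in phi a](_ : a = (2 * a + u) - (a + u)); last by field.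
    have [-> _] := free_solution_add (2 * a + u) (a + u) CS F.
    by have [-> _] := free_solution_sub (2 * a + u) (a + u) CS F; field.
  have shift3 : phi (5 * a / 2 + u) * C (a / 2 + u)
      = 2^-1 * (phi (3 * a + 2 * u) + phi (2 * a)).
    rewrite (_ : 3 * a + 2 * u = (5 * a / 2 + u) + (a / 2 + u)); last by field.
    rewrite (_ : 2 * a = (5 * a / 2 + u) - (a / 2 + u)); last by field.
    have [-> _] := free_solution_add (5 * a / 2 + u) (a / 2 + u) CS F.
    by have [-> _] := free_solution_sub (5 * a / 2 + u) (a / 2 + u) CS F; field.
  have shift4 : psi (5 * a / 2 + u) * C (u - a / 2)
      - lambda * phi (5 * a / 2 + u) * S (u - a / 2) = psi (2 * a + 2 * u).
    have [_ <-] := free_solution_add (5 * a / 2 + u) (u - a / 2) CS F.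
    by congr psi; field.
  have shift5 : phi (5 * a / 2 + u) * C (u - a / 2)
      + psi (5 * a / 2 + u) * S (u - a / 2) = phi (2 * a + 2 * u).
    have [<- _] := free_solution_add (5 * a / 2 + u) (u - a / 2) CS F.
    by congr phi; field.
  apply: (eq_by_multiple (c := - (s1 u + s2 u)) shift1).
  apply: (eq_by_multiple (c := - k u * (s1 u + s2 u)) shift2).
  apply: (eq_by_multiple (c := k u * (s1 u + s2 u)) shift3).
  apply: (eq_by_multiple (c := k u * (al1 u + al2 u)) shift4).
  apply: (eq_by_multiple (c := k u * lambda * (be1 u + be2 u)) shift5).
  apply: (eq_by_multiple (c := k u) (conv1 u)).
  apply: (eq_by_multiple (c := k u) (conv2 u)).
  apply: (eq_by_multiple (c := psi (2 * a + 2 * u)) (G u)).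
  ring.
have := cderive0_constantT dZ dZ0 b 0.
(* int_0^b k E = E(0) = 0, the fixed-point equation at w = 0. *)
have G0 : Ps1 0 + Ps2 0 = 0.
  by have := G 0; rewrite c10 c20 s10 s20 !mulr1 !mulr0 !subr0 addr0.
have [_ _ W20 dW20] := r2; have [_ _ W30 dW30] := r3.
rewrite /= !addr0 W10 dW10 W20 dW20 W30 dW30 Eb kb Ps1b Ps2b Pc1b Pc2b.
rewrite rc10 rc20 rs10 rs20 s10 s20 G0 => H.
apply: etrans (etrans H _); by ring.
Qed.

(** * Absolute continuity of functions started at a point *)

Lemma continuous_integrable (R : realType) (f : R -> R) (u v : R) : continuous f ->
  (@lebesgue_measure R).-integrable `[u, v] (EFin \o f).
Proof.
move=> cf; apply: continuous_compact_integrable; first exact: segment_compact.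
exact: continuous_subspaceT.
Qed.

Lemma integral_derivative (R : realType) (F f : R -> R) (u v : R) :
  (forall x : R, is_derive x 1 F (f x)) -> continuous f -> u <= v ->
  \int[@lebesgue_measure R]_(x in `[u, v]) f x = F v - F u.
Proof.
move=> dF cf; rewrite le_eqVlt => /predU1P[->|uv].
  by rewrite set_itv1 Rintegral_set1 subrr.
have cF : continuous F.
  by move=> x; apply/differentiable_continuous/derivable1_diffP.
rewrite /Rintegral (@continuous_FTC2 _ f F)//.
- exact: continuous_subspaceT.
- split; first by move=> x _; exact: ex_derive.
    exact/cvg_at_right_filter/cF.
  exact/cvg_at_left_filter/cF.
- by move=> x _; rewrite derive1E; exact: derive_val.
Qed.

Definition from {R : realType} {T : zmodType} (p : R) (f : R -> T) (x : R) : T :=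
  if p <= x then f x else 0.

Lemma fromE (R : realType) (p : R) (f : R -> R) : from p f = f \_ `[p, +oo[.
Proof.
by apply/funext => x; rewrite /from patchE mem_setE in_itv/= andbT.
Qed.

Lemma from_integrable (R : realType) (p : R) (f : R -> R) (u v : R) : continuous f ->
  (@lebesgue_measure R).-integrable `[u, v] (EFin \o from p f).
Proof.
move=> cf; rewrite fromE -restrict_EFin.
apply/integrable_restrict => //=.
by apply: integrableS (continuous_integrable u v cf) => //; exact: measurableI.
Qed.

Lemma from_integral (R : realType) (p : R) (F f : R -> R) (u v : R) :
  (forall x : R, is_derive x 1 F (f x)) -> continuous f -> F p = 0 -> u <= p ->
  \int[@lebesgue_measure R]_(x in `[u, v]) from p f x = from p F v.
Proof.
move=> dF cf Fp up; rewrite fromE -Rintegral_mkcondr /from.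
case: ifPn => [pv|]; last first.
  rewrite -ltNge => vp; rewrite (_ : _ `&` _ = set0) ?Rintegral_set0//.
  apply/seteqP; split => x //=; rewrite !in_itv/= andbT => -[/andP[_ xv] px].
  by move: (le_lt_trans xv vp); rewrite ltNge px.
rewrite (_ : _ `&` _ = `[p, v]%classic).
  by rewrite (integral_derivative dF)// Fp subr0.
apply/seteqP; split => x /=; rewrite !in_itv/= andbT.
  by move=> [/andP[_ ->] ->].
by move=> /andP[px ->]; rewrite px (le_trans up px).
Qed.

(** Since [f] vanishes at [p], switching it on there creates no jump. *)
Lemma AC_from (R : realType) (p : R) (f df ddf : R -> R[i]) :
  cderive f df -> cderive df ddf -> 0 <= p -> f p = 0 ->
  AC_with_derivative (from p f) (from p df).
Proof.
move=> hf hdf p0 fp; have [c1 c2] := cderive_continuous hdf.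
have ReE (g : R -> R[i]) x : Re (from p g x) = from p (fun t => Re (g t)) x.
  by rewrite /from; case: ifP.
have ImE (g : R -> R[i]) x : Im (from p g x) = from p (fun t => Im (g t)) x.
  by rewrite /from; case: ifP.
split.
  split.
    by under [X in EFin \o X]eq_fun do rewrite ReE; exact: from_integrable.
  by under [X in EFin \o X]eq_fun do rewrite ImE; exact: from_integrable.
move=> x; rewrite in_itv/= => /andP[x0 _].
have -> : from p f 0 = 0.
  by rewrite /from; case: ifP => // p0'; rewrite -fp (_ : p = 0)//; apply/le_anti/andP.
rewrite add0r /cintegral; apply: cplx_ext => /=.
  rewrite ReE; under eq_Rintegral do rewrite ReE.
  by rewrite (from_integral _ (fun t => (hf t).1))// fp.
rewrite ImE; under eq_Rintegral do rewrite ImE.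
by rewrite (from_integral _ (fun t => (hf t).2))// fp.
Qed.

Lemma AC_add (R : realType) (f g df dg : R -> R[i]) :
  AC_with_derivative f df -> AC_with_derivative g dg ->
  AC_with_derivative (fun x => f x + g x) (fun x => df x + dg x).
Proof.
move=> [[f1 f2] fE] [[g1 g2] gE]; split.
  split.
    rewrite (_ : EFin \o _ = (EFin \o (fun x => Re (df x))) \+ (EFin \o (fun x => Re (dg x)))).
      exact: integrableD.
    by apply/funext => x; rewrite /= cReD.
  rewrite (_ : EFin \o _ = (EFin \o (fun x => Im (df x))) \+ (EFin \o (fun x => Im (dg x)))).
    exact: integrableD.
  by apply/funext => x; rewrite /= cImD.
move=> x xpi; rewrite fE// gE// addrACA; congr +%R.
have sub : `[0, x] `<=` `[0, (pi : R)].
  move: xpi; rewrite in_itv/= => /andP[_ xpi].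
  by apply: subset_itvl; rewrite bnd_simp.
have S (u : R -> R) : (@lebesgue_measure R).-integrable `[0, pi] (EFin \o u) ->
    (@lebesgue_measure R).-integrable `[0, x] (EFin \o u).
  by apply: integrableS.
apply: cplx_ext; rewrite /cintegral /=.
  by rewrite -RintegralD//; [apply: eq_Rintegral => t _; rewrite cReD|exact: S..].
by rewrite -RintegralD//; [apply: eq_Rintegral => t _; rewrite cImD|exact: S..].
Qed.

(** * The solution before the potential acts *)

Lemma cintegral_derivative (R : realType) (F f : R -> R[i]) (u v : R) :
  cderive F f -> continuous (fun x => Re (f x)) -> continuous (fun x => Im (f x)) ->
  u <= v -> cintegral `[u, v] f = F v - F u.
Proof.
move=> dF c1 c2 uv; apply: cplx_ext; rewrite /cintegral /= ?cReD ?cImD ?cReN ?cImN.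
  by rewrite (integral_derivative (fun t => (dF t).1)).
by rewrite (integral_derivative (fun t => (dF t).2)).
Qed.

Lemma eq_cintegral (R : realType) (D : set R) (f g : R -> R[i]) :
  {in D, f =1 g} -> cintegral D f = cintegral D g.
Proof.
by move=> fg; rewrite /cintegral; congr (_ +i* _); apply: eq_Rintegral => x xD;
  rewrite fg.
Qed.

#[local] Instance lebesgue_ae_filter (R : realType) :
  Filter (nbhs (almost_everywhere (@lebesgue_measure R))).
Proof. exact: (ae_filter_ringOfSetsType (@lebesgue_measure R)). Qed.

Lemma ae_neq (R : realType) (p : R) : {ae @lebesgue_measure R, forall t, t != p}.
Proof.
exists [set p]; split; [exact: measurable_set1 | exact: lebesgue_measure_set1 |].
by move=> t /= /negP; rewrite negbK => /eqP.
Qed.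

Lemma ae_eq_Rintegral (R : realType) (D : set R) (f g : R -> R) :
  measurable D -> measurable_fun D f -> measurable_fun D g ->
  {ae @lebesgue_measure R, forall x, D x -> f x = g x} ->
  \int[@lebesgue_measure R]_(x in D) f x = \int[@lebesgue_measure R]_(x in D) g x.
Proof.
move=> mD mf mg fg; rewrite /Rintegral; congr fine.
apply: ae_eq_integral => //; [exact/measurable_EFinP..|].
by apply: filterS fg => x + Dx => /(_ Dx) ->.
Qed.

Lemma integrable_measurable (R : realType) (D E : set R) (f : R -> R) :
  measurable E -> E `<=` D -> measurable D ->
  (@lebesgue_measure R).-integrable D (EFin \o f) -> measurable_fun E f.
Proof.
move=> mE ED mD /(measurable_int (@lebesgue_measure R)) mf.
by apply/measurable_EFinP; exact: measurable_funS mf.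
Qed.

Lemma continuous_measurable (R : realType) (E : set R) (f : R -> R) :
  continuous f -> measurable_fun E f.
Proof.
by move=> cf; apply: measurable_funTS; exact: continuous_measurable_fun.
Qed.

(** Extends a function continuous on a segment to the line by constants. *)
Lemma continuous_clamp (R : realType) (f : R -> R) (u v : R) : u <= v ->
  {within `[u, v], continuous f} ->
  continuous (fun x => f (Num.max u (Num.min v x))).
Proof.
move=> uv /subspace_continuousP cf x.
pose cl t := Num.max u (Num.min v t).
have clI t : `[u, v]%classic (cl t).
  by rewrite /= in_itv/= le_max lexx/= ge_max uv ge_min lexx.
have ccl : continuous cl.
  move=> t; apply: (@continuous_max R R (cst u) (fun t => Num.min v t)).
    exact: cst_continuous.
  apply: (@continuous_min R R (cst v) id) => //; exact: cst_continuous.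
have : cl y @[y --> x] --> within `[u, v]%classic (nbhs (cl x)).
  move=> P PW.
  have H : \forall t \near x, `[u, v]%classic (cl t) -> P (cl t) := ccl x _ PW.
  suff : \forall t \near x, P (cl t) by [].
  by apply: filterS H => t Ht; exact: Ht (clI t).
by move=> H; exact: (@cvg_comp _ _ _ cl f _ _ _ H (cf _ (clI x))).
Qed.

(** An absolutely continuous function is continuous on [0, pi] only; a continuous
    extension has primitives on the whole line. *)
Lemma AC_extension (R : realType) (f df : R -> R[i]) :
  AC_with_derivative f df -> exists g : R -> R[i],
  [/\ continuous (fun x => Re (g x)), continuous (fun x => Im (g x)) &
      forall x, x \in `[0, (pi : R)] -> f x = g x].
Proof.
move=> [[i1 i2] fE]; have pi0 : 0 <= (pi : R) by exact: pi_ge0.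
have cst_add (c : R) (h : R -> R) : continuous h -> continuous (fun x => c + h x).
  by move=> ch x; apply: cvgD; [exact: cvg_cst | exact: ch].
exists (fun x => f 0 + cintegral `[0, Num.max 0 (Num.min pi x)] df); split.
- under eq_fun do rewrite cReD /cintegral /=.
  exact: cst_add (continuous_clamp pi0 (parameterized_integral_continuous pi0 i1)).
- under eq_fun do rewrite cImD /cintegral /=.
  exact: cst_add (continuous_clamp pi0 (parameterized_integral_continuous pi0 i2)).
- move=> x xpi; rewrite fE//; move: xpi; rewrite in_itv/= => /andP[x0 xpi].
  have -> : Num.min pi x = x by exact: min_r.
  by have -> : Num.max 0 x = x by exact: max_r.
Qed.

(** The equation holds almost everywhere and between integrals.  Let P be the
    primitive of y and Q that of P, both vanishing at 0; the equation reads
    y' = - lambda P and y = 1 - lambda Q on [0, m].  So P - S and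
    1 - lambda Q - C satisfy the system of [harmonic_zero]. *)
Lemma initial_solution (R : realType) (lambda : R[i]) (C S y dy d2y : R -> R[i]) (m : R) :
  cosine_sine lambda C S -> AC_with_derivative y dy -> AC_with_derivative dy d2y ->
  y 0 = 1 -> dy 0 = 0 -> 0 <= m <= pi ->
  {ae @lebesgue_measure R, forall x, x \in `]0, m[ -> d2y x = - lambda * y x} ->
  forall x, 0 <= x <= m -> y x = C x.
Proof.
move=> CS ACy [[id1 id2] dyE] y0 dy0 /andP[m0 mpi] ode.
have [g [cg1 cg2 gE]] := AC_extension ACy.
have in_pi x : 0 <= x <= m -> x \in `[0, (pi : R)].
  by rewrite in_itv/= => /andP[-> /le_trans]; apply.
have [P P0 dP] := continuous_cprimitive 0 cg1 cg2.
have [Q Q0 dQ] := cderive_primitive 0 dP.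
have [cP1 cP2] := cderive_continuous dP.
have lin (c d : R) : continuous (fun x => c * Re (g x) + d * Im (g x)).
  move=> x; apply: (@cvgD _ R^o); apply: (@cvgM R); try exact: cvg_cst.
    exact: cg1.
  exact: cg2.
have lg1 : continuous (fun x => Re (- lambda * g x)).
  rewrite (_ : (fun x => _) = (fun x => Re (- lambda) * Re (g x) + Im lambda * Im (g x))).
    exact: lin.
  by apply/funext => x; rewrite cReM cImN mulNr opprK.
have lg2 : continuous (fun x => Im (- lambda * g x)).
  rewrite (_ : (fun x => _) = (fun x => Im (- lambda) * Re (g x) + Re (- lambda) * Im (g x))).
    exact: lin.
  by apply/funext => x; rewrite cImM addrC.
have dyP x : 0 <= x <= m -> dy x = - lambda * P x.
  move=> xm; have /andP[x0 xm'] := xm.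
  rewrite dyE ?in_pi// dy0 add0r.
  have -> : - lambda * P x = - lambda * P x - - lambda * P 0.
    by rewrite P0 mulr0 subr0.
  rewrite -(cintegral_derivative (cderiveZ (- lambda) dP))//.
  have sub : `[0, x]%classic `<=` `[0, (pi : R)]%classic.
    by apply: subset_itvl; rewrite bnd_simp (le_trans xm').
  have aeq : {ae @lebesgue_measure R, forall t, `[0, x]%classic t ->
      d2y t = - lambda * g t}.
    apply: filterS3 (ae_neq 0) (ae_neq x) ode => t t0 tx H; rewrite /= in_itv/= => /andP[t0' tx'].
    rewrite H; last first.
      by rewrite in_itv/= lt_neqAle eq_sym t0 t0' /= (lt_le_trans _ xm')// lt_neqAle tx.
    by rewrite gE// in_pi// t0' (le_trans tx').
  apply: cplx_ext; rewrite /cintegral /=; apply: ae_eq_Rintegral => //.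
  - by apply: (integrable_measurable _ sub _ id1).
  - exact: continuous_measurable.
  - by apply: filterS aeq => t H /H ->.
  - by apply: (integrable_measurable _ sub _ id2).
  - exact: continuous_measurable.
  - by apply: filterS aeq => t H /H ->.
have yQ x : 0 <= x <= m -> y x = 1 - lambda * Q x.
  move=> xm; have /andP[x0 xm'] := xm.
  have [_ ->] := ACy; rewrite ?in_pi// y0.
  have -> : - (lambda * Q x) = - lambda * Q x - - lambda * Q 0.
    by rewrite Q0 mulr0 subr0 mulNr.
  rewrite -(cintegral_derivative (cderiveZ (- lambda) dQ))//; last 2 first.
  - by have [] := cderive_continuous (cderiveZ (- lambda) dP).
  - by have [] := cderive_continuous (cderiveZ (- lambda) dP).
  congr (_ + _); apply: eq_cintegral => t; rewrite inE/= in_itv/= => /andP[t0 tx].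
  by rewrite dyP// t0 (le_trans tx).
have [dC dS C0 S0] := CS.
have dX := cderiveD dP (cderiveN dS).
have dD := cderiveD (cderiveD (cderive_cst 1) (cderiveN (cderiveZ lambda dQ))) (cderiveN dC).
have Z := @harmonic_zero _ lambda _ _ _ _ 0 m 0 dX dD.
move=> x xm; rewrite yQ//.
have [] := Z _ _ _ _ x xm; rewrite /= ?lexx ?m0 ?P0 ?Q0 ?S0 ?C0//; try by ring.
  move=> z zm; rewrite -gE ?in_pi// yQ//; split; ring.
by move=> _ /eqP; rewrite subr_eq0 => /eqP.
Qed.

(** * The functions h1 and e1 *)

Lemma real_cosine_sine (R : realType) (k : R) : k != 0 ->
  cosine_sine (k%:C ^+ 2) (fun u => (cos (k * u))%:C) (fun u => (sin (k * u))%:C / k%:C).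
Proof.
move=> k0; have kC0 : k%:C != 0 :> R[i] by rewrite fmorph_eq0.
have dc : cderive (fun x => (cos x)%:C) (fun x => (- sin x)%:C : R[i]).
  by apply: cderive_real => x; exact: is_derive_cos.
have ds : cderive (fun x => (sin x)%:C) (fun x => (cos x)%:C : R[i]).
  by apply: cderive_real => x; exact: is_derive_sin.
split.
- apply: cderive_ext (cderive_eq (cderive_comp_affine 0 k dc) _) _ => x; last first.
    by rewrite add0r.
  by rewrite add0r raddfN; field.
- apply: cderive_eq.
    apply: cderive_ext (cderiveZ (k%:C)^-1 (cderive_comp_affine 0 k ds)) _ => x.
    by rewrite add0r mulrC.
  by move=> x /=; rewrite add0r; field.
- by rewrite mulr0 cos0.
- by rewrite mulr0 sin0 mul0r.
Qed.

Lemma is_derive_cos_affine (R : realType) (p s x : R) :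
  is_derive x 1 (fun u : R => cos (p + s * u)) (- (s * sin (p + s * x))).
Proof.
have := cderive_comp_affine p s (cderive_real (@is_derive_cos R)) x.
by case=> + _; rewrite cReM /= mul0r subr0 mulrN.
Qed.

Lemma is_derive_sin_affine (R : realType) (p s x : R) :
  is_derive x 1 (fun u : R => sin (p + s * u)) (s * cos (p + s * x)).
Proof.
have := cderive_comp_affine p s (cderive_real (@is_derive_sin R)) x.
by case=> + _; rewrite cReM /= mul0r subr0.
Qed.

Lemma is_derive_scale (R : realType) (c : R) (f : R -> R) (x df : R) :
  is_derive x 1 f df -> is_derive x 1 (fun u => c * f u) (c * df).
Proof. by move=> h; exact: (@is_deriveZ _ _ _ f c x 1 df h). Qed.

Lemma is_derive_sin_div (R : realType) (k x : R) : k != 0 ->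
  is_derive x 1 (fun u => sin (k * u) / k) (cos (k * x)).
Proof.
move=> k0; have := is_derive_scale k^-1 (is_derive_sin_affine 0 k x).
rewrite add0r mulKf// (_ : (fun u : R => _) = (fun u => sin (k * u) / k))//.
by apply/funext => u; rewrite add0r mulrC.
Qed.

(** With b = pi - 5a/2, the functions [profile], [envelope], [profile_tail] and
    [envelope_integral] below are h1 at 5a/2 + u, e1 at 3a/2 + u, the integral of
    h1 from 5a/2 + u to pi and the integral of e1 from 3a/2 to 3a/2 + u. *)
Definition frequency (R : realType) (b : R) : R := pi * Num.sqrt 10 / (2 * b).

Definition height (R : realType) (b : R) : R := 3 * pi ^+ 2 / (2 * b ^+ 2).

Definition profile (R : realType) (b u : R) : R :=
  height b * cos (frequency b * (b - u)).

Definition profile_tail (R : realType) (b u : R) : R :=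
  height b / frequency b * sin (frequency b * (b - u)).

Definition envelope (R : realType) (b u : R) : R :=
  cos (pi / b * u) + cos (2 * pi / b * u).

Definition envelope_integral (R : realType) (b u : R) : R :=
  sin (pi / b * u) / (pi / b) + sin (2 * pi / b * u) / (2 * pi / b).

Lemma pi_neq0 (R : realType) : (pi : R) != 0.
Proof. by rewrite gt_eqF ?pi_gt0. Qed.

Lemma frequency_neq0 (R : realType) (b : R) : 0 < b -> frequency b != 0.
Proof.
move=> b0; apply: lt0r_neq0; apply: divr_gt0; last by rewrite mulr_gt0.
by rewrite mulr_gt0 ?pi_gt0 ?sqrtr_gt0.
Qed.

Lemma frequency_sqr (R : realType) (b : R) : frequency b ^+ 2 = 5 / 3 * height b.
Proof.
rewrite /frequency /height expr_div_n exprMn sqr_sqrtr//.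
have [->|b0] := eqVneq b 0; first by rewrite !(mulr0, expr0n, invr0).
by field.
Qed.

Lemma profile_tail_derive (R : realType) (b x : R) : 0 < b ->
  is_derive x 1 (profile_tail b) (- profile b x).
Proof.
move=> b0; have f0 := frequency_neq0 b0.
have := is_derive_scale (height b / frequency b)
  (is_derive_sin_affine (frequency b * b) (- frequency b) x).
rewrite (_ : (fun u : R => _) = profile_tail b); last first.
  by apply/funext => u; rewrite /profile_tail mulrBr mulNr.
move=> h; apply: (is_derive_eq h).
by rewrite /profile mulrBr !mulNr; field.
Qed.

Lemma profile_derive (R : realType) (b x : R) : 0 < b ->
  is_derive x 1 (profile b) (frequency b ^+ 2 * profile_tail b x).
Proof.
move=> b0; have f0 := frequency_neq0 b0.
have := is_derive_scale (height b)
  (is_derive_cos_affine (frequency b * b) (- frequency b) x).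
rewrite (_ : (fun u : R => _) = profile b); last first.
  by apply/funext => u; rewrite /profile mulrBr mulNr.
move=> h; apply: (is_derive_eq h).
by rewrite /profile_tail mulrBr !mulNr; field.
Qed.

Lemma envelope_integral_derive (R : realType) (b x : R) : 0 < b ->
  is_derive x 1 (envelope_integral b) (envelope b x).
Proof.
move=> b0; have p0 := pi_neq0 R; have b0' : b != 0 by rewrite gt_eqF.
apply: (@is_deriveD _ _ _ (fun u => sin (pi / b * u) / (pi / b))
  (fun u => sin (2 * pi / b * u) / (2 * pi / b))); apply: is_derive_sin_div.
  by rewrite mulf_neq0 ?invr_eq0.
by rewrite !mulf_neq0 ?invr_eq0.
Qed.

Lemma envelope_continuous (R : realType) (b : R) : continuous (envelope b).
Proof.
have d (x : R) : is_derive x 1 (envelope b)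
   (- (pi / b * sin (pi / b * x)) - 2 * pi / b * sin (2 * pi / b * x)).
  rewrite (_ : envelope b = (fun u : R => cos (0 + pi / b * u)) +
      (fun u => cos (0 + 2 * pi / b * u))).
    apply: (is_derive_eq (is_deriveD (is_derive_cos_affine 0 (pi / b) x)
      (is_derive_cos_affine 0 (2 * pi / b) x))).
    by rewrite !add0r.
  by apply/funext => u; rewrite /envelope fctE !add0r.
by move=> x; apply/differentiable_continuous/derivable1_diffP.
Qed.

(** The reflection in b/2 preserves the first mode and changes the sign of the
    second one. *)
Lemma sin_reflect (R : realType) (b w : R) : 0 < b ->
  sin (pi / b * (b - w)) = sin (pi / b * w) /\
  sin (2 * pi / b * (b - w)) = - sin (2 * pi / b * w).
Proof.
move=> b0; have b0' : b != 0 by rewrite gt_eqF.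
rewrite (_ : pi / b * (b - w) = pi - pi / b * w); last by field.
rewrite (_ : 2 * pi / b * (b - w) = (pi - 2 * pi / b * w) + pi); last by field.
by rewrite sinDpi !sinB sinpi cospi; split; ring.
Qed.

Lemma envelope_integral_end (R : realType) (b : R) : 0 < b ->
  envelope_integral b b = 0.
Proof.
move=> b0; have [] := sin_reflect 0 b0.
rewrite subr0 !mulr0 sin0 oppr0 /envelope_integral => -> ->.
by rewrite !mul0r addr0.
Qed.

Lemma profile_tail_end (R : realType) (b : R) : profile_tail b b = 0.
Proof. by rewrite /profile_tail subrr mulr0 sin0 mulr0. Qed.

Lemma profile_end (R : realType) (b : R) : profile b b = height b.
Proof. by rewrite /profile subrr mulr0 cos0 mulr1. Qed.

Lemma h1E (R : realType) (a x : R) : 0 < pi - 5 * a / 2 ->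
  h1 a x = profile (pi - 5 * a / 2) (x - 5 * a / 2).
Proof.
rewrite /h1 /profile /height /frequency.
rewrite (_ : 2 * pi - 5 * a = 2 * (pi - 5 * a / 2)); last by field.
rewrite (_ : pi - 5 * a / 2 - (x - 5 * a / 2) = pi - x); last by ring.
move: (pi - 5 * a / 2) => b /lt0r_neq0 b0.
by congr (_ * cos _); field.
Qed.

Lemma e1E (R : realType) (a x : R) : 0 < pi - 5 * a / 2 ->
  e1 a x = envelope (pi - 5 * a / 2) (x - 3 * a / 2).
Proof.
rewrite /e1 /envelope [RHS]addrC.
rewrite (_ : 2 * pi - 5 * a = 2 * (pi - 5 * a / 2)); last by field.
rewrite (_ : 2 * x - 3 * a = 2 * (x - 3 * a / 2)); last by field.
move: (pi - 5 * a / 2) => b /lt0r_neq0 b0.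
by congr (cos _ + cos _); field.
Qed.

Lemma K_h1E (R : realType) (a x : R) : 0 < pi - 5 * a / 2 -> x <= pi ->
  K_ (h1 a) x = profile_tail (pi - 5 * a / 2) (x - 5 * a / 2).
Proof.
move=> b0 xpi; rewrite /K_.
have dt (y : R) : is_derive y 1
    (fun t => - profile_tail (pi - 5 * a / 2) (t - 5 * a / 2)) (h1 a y).
  have := cderive_shiftB (5 * a / 2)
    (cderive_real (fun u => profile_tail_derive u b0)) y.
  by case=> /is_deriveN + _; rewrite /= opprK h1E.
have ch : continuous (h1 a).
  have d (y : R) : is_derive y 1 (h1 a) (frequency (pi - 5 * a / 2) ^+ 2 *
      profile_tail (pi - 5 * a / 2) (y - 5 * a / 2)).
    have := cderive_shiftB (5 * a / 2)
      (cderive_real (fun u => profile_derive u b0)) y.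
    by case=> + _; rewrite (_ : (fun t => _) = h1 a)//; apply/funext => t; rewrite h1E.
  by move=> y; apply/differentiable_continuous/derivable1_diffP.
rewrite (integral_derivative dt ch xpi) opprK.
by rewrite profile_tail_end oppr0 add0r.
Qed.

Lemma integral_e1E (R : realType) (a x : R) : 0 < pi - 5 * a / 2 -> 3 * a / 2 <= x ->
  \int[@lebesgue_measure R]_(t in `[3 * a / 2, x]) e1 a t =
  envelope_integral (pi - 5 * a / 2) (x - 3 * a / 2).
Proof.
move=> b0 ax.
have dt (y : R) : is_derive y 1
    (fun t => envelope_integral (pi - 5 * a / 2) (t - 3 * a / 2)) (e1 a y).
  have := cderive_shiftB (3 * a / 2)
    (cderive_real (fun u => envelope_integral_derive u b0)) y.
  by case=> + _; rewrite /= e1E.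
have ce : continuous (e1 a).
  rewrite (_ : e1 a = (fun x : R => envelope (pi - 5 * a / 2) (x - 3 * a / 2))).
    move=> y; apply: (@continuous_comp _ _ _ (fun t => t - 3 * a / 2)).
      by apply: cvgB; [exact: cvg_id | exact: cvg_cst].
    exact: envelope_continuous.
  by apply/funext => y; rewrite e1E.
rewrite (integral_derivative dt ce ax) subrr /envelope_integral.
by rewrite !mulr0 sin0 !mul0r addr0 subr0.
Qed.

(** * The potential on its windows *)

Lemma from_ge (R : realType) (T : zmodType) (p : R) (f : R -> T) (x : R) :
  p <= x -> from p f x = f x.
Proof. by rewrite /from => ->. Qed.

Lemma from_lt (R : realType) (T : zmodType) (p : R) (f : R -> T) (x : R) :
  x < p -> from p f x = 0.
Proof. by rewrite /from leNgt => ->. Qed.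

(** The second factor is the direction in which the family varies. *)
Lemma q1_affine (R : realType) (a : R) (alpha : R[i]) (x : R) :
  q1 a alpha x = q1 a 0 x + alpha * (q1 a 1 x - q1 a 0 x).
Proof. by rewrite /q1 /q_family; case: ifP => _; [|case: ifP => _; [|case: ifP => _]]; ring. Qed.

Lemma q1_first (R : realType) (a x : R) (alpha : R[i]) : a < 2 * pi / 5 ->
  3 * a / 2 < x < pi - a ->
  q1 a alpha x = alpha * (envelope (pi - 5 * a / 2) (x - 3 * a / 2))%:C.
Proof. by move=> ha xI; rewrite /q1 /q_family xI e1E//; lra. Qed.

Lemma q1_second (R : realType) (a x : R) (alpha : R[i]) :
  pi / 3 <= a -> a < 2 * pi / 5 -> 2 * a < x < pi - a / 2 ->
  q1 a alpha x = - alpha * (profile_tail (pi - 5 * a / 2) (x - 2 * a))%:C *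
    (envelope_integral (pi - 5 * a / 2) (x - 2 * a))%:C.
Proof.
move=> ha ha' xI; have /andP[x1 x2] := xI.
rewrite /q1 /q_family ifF; last by apply/negbTE/negP => /andP[]; lra.
rewrite xI K_h1E; [|lra|lra]; rewrite integral_e1E; [|lra|lra].
rewrite (_ : x + a / 2 - 5 * a / 2 = x - 2 * a); last by field.
by rewrite (_ : x - a / 2 - 3 * a / 2 = x - 2 * a); last by field.
Qed.

Lemma q1_third (R : realType) (a x : R) (alpha : R[i]) :
  pi / 3 <= a -> a < 2 * pi / 5 -> 5 * a / 2 < x < pi ->
  q1 a alpha x = (profile (pi - 5 * a / 2) (x - 5 * a / 2))%:C.
Proof.
move=> ha ha' xI; have /andP[x1 x2] := xI.
rewrite /q1 /q_family ifF; last by apply/negbTE/negP => /andP[]; lra.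
rewrite ifF; last by apply/negbTE/negP => /andP[]; lra.
by rewrite xI h1E//; lra.
Qed.

Lemma q1_zero (R : realType) (a x : R) (alpha : R[i]) :
  pi / 3 <= a -> a < 2 * pi / 5 ->
  [\/ x <= 3 * a / 2, pi - a <= x <= 2 * a | pi - a / 2 <= x <= 5 * a / 2] ->
  q1 a alpha x = 0.
Proof.
move=> ha ha' H; rewrite /q1 /q_family.
rewrite ifF; last by apply/negbTE/negP => /andP[]; case: H => [|/andP[]|/andP[]]; lra.
rewrite ifF; last by apply/negbTE/negP => /andP[]; case: H => [|/andP[]|/andP[]]; lra.
rewrite ifF//; apply/negbTE/negP => /andP[]; case: H => [|/andP[]|/andP[]]; lra.
Qed.

Lemma AC_response (R : realType) (lambda d : R[i]) (g dg W dW : R -> R[i]) (p : R) :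
  cderive g dg -> response lambda g p W dW -> 0 <= p ->
  AC_with_derivative (fun x => d * from p W x) (fun x => d * from p dW x) /\
  AC_with_derivative (fun x => d * from p dW x)
    (fun x => d * from p (fun t => - lambda * W t + g t) x).
Proof.
move=> hg [hW hdW Wp dWp] p0.
have fromZ (f : R -> R[i]) :
    (fun x => d * from p f x) = from p (fun x => d * f x).
  by apply/funext => x; rewrite /from; case: ifP; rewrite ?mulr0.
rewrite !fromZ; split; apply: AC_from => //.
- exact: cderiveZ hW.
- exact: cderiveZ hdW.
- by rewrite Wp mulr0.
- exact: cderiveZ hdW.
- exact: (cderiveZ d (cderiveD (cderiveZ (- lambda) hW) hg)).
- by rewrite dWp mulr0.
Qed.

(** Packs what [responses_cancel] asks of h1 and e1.  The tuning is in the last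
    two equations: kappa_1 = (pi/b)^2 and kappa_2 = 4 (pi/b)^2 lie at the same
    distance 3/2 (pi/b)^2, on opposite sides, from gamma = 5/2 (pi/b)^2, and this
    distance is also the value of h1 at pi. *)
Lemma envelope_data (R : realType) (b : R) : 0 < b ->
  exists k1 k2 gamma h0 : R[i], exists c1 s1 c2 s2 k h : R -> R[i],
  [/\ cosine_sine k1 c1 s1, cosine_sine k2 c2 s2,
      (forall u, c1 u + c2 u = (envelope b u)%:C),
      (forall u, s1 u + s2 u = (envelope_integral b u)%:C) &
      (forall w, s1 (b - w) - s2 (b - w) = s1 w + s2 w)] /\
  [/\ (forall u, k u = (profile_tail b u)%:C), (forall u, h u = (profile b u)%:C),
      cderive k (fun u => - h u), cderive h (fun u => gamma * k u) &
      [/\ h b = h0, h0 != 0, k1 - gamma = - h0 & k2 - gamma = h0]].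
Proof.
move=> b0; have b0' : b != 0 by rewrite gt_eqF.
have p0 := pi_neq0 R.
have n1 : pi / b != 0 by rewrite mulf_neq0 ?invr_eq0.
have n2 : 2 * pi / b != 0 by rewrite !mulf_neq0 ?invr_eq0.
exists ((pi / b)%:C ^+ 2), ((2 * pi / b)%:C ^+ 2), ((frequency b ^+ 2)%:C).
exists ((height b)%:C), (fun u => (cos (pi / b * u))%:C).
exists (fun u => (sin (pi / b * u))%:C / (pi / b)%:C).
exists (fun u => (cos (2 * pi / b * u))%:C).
exists (fun u => (sin (2 * pi / b * u))%:C / (2 * pi / b)%:C).
exists (fun u => (profile_tail b u)%:C), (fun u => (profile b u)%:C).
split; split.
- exact: real_cosine_sine.
- exact: real_cosine_sine.
- by move=> u; rewrite -rmorphD.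
- by move=> u; rewrite -!fmorph_div -rmorphD.
- by move=> w; have [-> ->] := sin_reflect w b0; rewrite rmorphN mulNr opprK.
- by [].
- by [].
- have := cderive_real (fun u => profile_tail_derive u b0).
  by move=> /cderive_eq; apply=> x; rewrite rmorphN.
- have := cderive_real (fun u => profile_derive u b0).
  by move=> /cderive_eq; apply=> x; rewrite rmorphM.
- split; first by rewrite profile_end.
  + rewrite fmorph_eq0 /height !mulf_neq0 ?invr_eq0 ?mulf_neq0 ?expf_neq0 ?pnatr_eq0//.
  + rewrite -rmorphXn -rmorphB -rmorphN; congr (_%:C).
    by rewrite frequency_sqr /height; field.
  + rewrite -rmorphXn -rmorphB; congr (_%:C).
    by rewrite frequency_sqr /height; field.
Qed.

(** * The correction between two members of the family *)

Lemma AC_ext (R : realType) (f g df dg : R -> R[i]) :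
  (forall x, f x = g x) -> (forall x, df x = dg x) ->
  AC_with_derivative f df -> AC_with_derivative g dg.
Proof. by move=> /funext -> /funext ->. Qed.

(** Two responses to the same forcing, started at [p] and at [p'], differ after
    [p'] by a free solution: their difference is the effect of the forcing between
    [p] and [p']. *)
Lemma wronskian_increment (R : realType)
    (lambda : R[i]) (phi psi g W dW W' dW' : R -> R[i]) (p p' x : R) :
  free_solution lambda phi psi ->
  response lambda g p W dW -> response lambda g p' W' dW' ->
  (phi x * dW x - psi x * W x) - (phi x * dW' x - psi x * W' x) =
  phi p' * dW p' - psi p' * W p'.
Proof.
move=> F r r'; have [_ _ W'p dW'p] := r'.
have := cderive0_constantT
  (cderiveD (wronskian_derive F r) (cderiveN (wronskian_derive F r'))) _ x p'.
by rewrite /= W'p dW'p => ->; [ring | move=> y; ring].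
Qed.

(** The forcings of the first two windows are switched on at the left ends and,
    through [f1'] and [f2'], off again at the right ends; that of the third window
    acts until pi. *)
Definition switched (R : realType) (a : R) (f1 f1' f2 f2' f3 : R -> R[i]) (x : R) : R[i] :=
  from (3 * a / 2) f1 x - from (pi - a) f1' x + from (2 * a) f2 x
  - from (pi - a / 2) f2' x + from (5 * a / 2) f3 x.

Lemma switchedE (R : realType) (a : R) (f1 f1' f2 f2' f3 : R -> R[i]) (x : R) :
  pi / 3 <= a -> a < 2 * pi / 5 ->
  [/\ x < 3 * a / 2 -> switched a f1 f1' f2 f2' f3 x = 0,
      3 * a / 2 < x < pi - a -> switched a f1 f1' f2 f2' f3 x = f1 x,
      pi - a < x < 2 * a -> switched a f1 f1' f2 f2' f3 x = f1 x - f1' x,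
      2 * a < x < pi - a / 2 ->
        switched a f1 f1' f2 f2' f3 x = f1 x - f1' x + f2 x &
      [/\ pi - a / 2 < x < 5 * a / 2 ->
            switched a f1 f1' f2 f2' f3 x = f1 x - f1' x + f2 x - f2' x &
          5 * a / 2 < x ->
            switched a f1 f1' f2 f2' f3 x = f1 x - f1' x + f2 x - f2' x + f3 x]].
Proof.
move=> ha ha'; rewrite /switched; repeat split; move=> H;
  try (case/andP: H => H H');
  do 5 (first [rewrite from_ge; [|lra] | rewrite from_lt; [|lra]]); ring.
Qed.

(** [V] is assembled from five responses by [switched].  The breakpoints are
    excluded in the differential equation because [d2V] takes one-sided values
    there.  For d = beta - alpha, d V is what has to be added to a solution for
    alpha; the factor d is part of the statements on absolute continuity because
    there real and imaginary parts are separated. *)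
Lemma correction_exists (R : realType) (a : R) (lambda : R[i]) (C S : R -> R[i]) :
  pi / 3 <= a -> a < 2 * pi / 5 -> cosine_sine lambda C S ->
  exists V dV d2V : R -> R[i],
  [/\ forall d, AC_with_derivative (fun x => d * V x) (fun x => d * dV x),
      forall d, AC_with_derivative (fun x => d * dV x) (fun x => d * d2V x),
      forall x, x < 3 * a / 2 -> V x = 0 /\ dV x = 0,
      V pi = 0 /\ dV pi = 0 &
      forall x, 0 < x < pi ->
        [&& x != 3 * a / 2, x != pi - a, x != 2 * a, x != pi - a / 2 & x != 5 * a / 2] ->
        d2V x = - lambda * V x + (q1 a 1 x - q1 a 0 x) * C (x - a)
                + q1 a 0 x * V (x - a)].
Proof.
move=> ha ha' CS; have [dC dS C0 S0] := CS.
pose b := pi - 5 * a / 2.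
have b0 : 0 < b by rewrite /b; lra.
have [k1 [k2 [gam [h0 [c1 [s1 [c2 [s2 [k [h]]]]]]]]]] := envelope_data b0.
move=> [[cs1 cs2 cE sE srefl] [kE hE dk dh [hb h00 k1g k2g]]].
have kb : k b = 0 by rewrite kE profile_tail_end.
have Eb : s1 b + s2 b = 0 by rewrite sE envelope_integral_end.
have [dc1 ds1 _ _] := cs1; have [dc2 ds2 _ _] := cs2.
have dg1 := cderiveM (cderiveD (cderive_shiftB (3 * a / 2) dc1)
  (cderive_shiftB (3 * a / 2) dc2)) (cderive_shiftB a dC).
have dg2 := cderiveM (cderiveM (cderiveN (cderive_shiftB (2 * a) dk))
  (cderiveD (cderive_shiftB (2 * a) ds1) (cderive_shiftB (2 * a) ds2)))
  (cderive_shiftB a dC).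
have [W1 [dW1 r1]] := response_exists lambda (3 * a / 2) dg1.
have [W1' [dW1' r1']] := response_exists lambda (pi - a) dg1.
have [W2 [dW2 r2]] := response_exists lambda (2 * a) dg2.
have [W2' [dW2' r2']] := response_exists lambda (pi - a / 2) dg2.
have [hW1 _ _ _] := r1.
have dg3 := cderiveM (cderive_shiftB (5 * a / 2) dh) (cderive_shiftB a hW1).
have [W3 [dW3 r3]] := response_exists lambda (5 * a / 2) dg3.
have cancel phi psi := responses_cancel CS cs1 cs2 Eb srefl dk dh kb hb h00 k1g k2g r1 r2 r3
  (phi := phi) (psi := psi).
pose dd (W g : R -> R[i]) (t : R) : R[i] := - lambda * W t + g t.
pose g1 (x : R) : R[i] := (c1 (x - 3 * a / 2) + c2 (x - 3 * a / 2)) * C (x - a).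
pose g2 (x : R) : R[i] :=
  - k (x - 2 * a) * (s1 (x - 2 * a) + s2 (x - 2 * a)) * C (x - a).
pose g3 (x : R) : R[i] := h (x - 5 * a / 2) * W1 (x - a).
exists (switched a W1 W1' W2 W2' W3), (switched a dW1 dW1' dW2 dW2' dW3).
exists (switched a (dd W1 g1) (dd W1' g1) (dd W2 g2) (dd W2' g2) (dd W3 g3)).
have p1 : 0 <= 3 * a / 2 by lra.
have p1' : 0 <= pi - a by lra.
have p2 : 0 <= 2 * a by lra.
have p2' : 0 <= pi - a / 2 by lra.
have p3 : 0 <= 5 * a / 2 by lra.
have sumZ d f1 f1' f2 f2' f3 x : d * from (3 * a / 2) f1 x
    + (- d) * from (pi - a) f1' x + d * from (2 * a) f2 x
    + (- d) * from (pi - a / 2) f2' x + d * from (5 * a / 2) f3 x =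
    d * switched a f1 f1' f2 f2' f3 x by rewrite /switched; ring.
have AC1 d := AC_response d dg1 r1 p1.
have AC1' d := AC_response (- d) dg1 r1' p1'.
have AC2 d := AC_response d dg2 r2 p2.
have AC2' d := AC_response (- d) dg2 r2' p2'.
have AC3 d := AC_response d dg3 r3 p3.
split.
- move=> d; apply: AC_ext (AC_add (AC_add (AC_add (AC_add (AC1 d).1 (AC1' d).1)
    (AC2 d).1) (AC2' d).1) (AC3 d).1) => x; exact: sumZ.
- move=> d; apply: AC_ext (AC_add (AC_add (AC_add (AC_add (AC1 d).2 (AC1' d).2)
    (AC2 d).2) (AC2' d).2) (AC3 d).2) => x; exact: sumZ.
- move=> x x1.
  have [-> // _ _ _ _] := switchedE W1 W1' W2 W2' W3 x ha ha'.
  by have [-> // _ _ _ _] := switchedE dW1 dW1' dW2 dW2' dW3 x ha ha'.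
- have p5 : 5 * a / 2 < pi by lra.
  have FE f1 f1' f2 f2' f3 : switched a f1 f1' f2 f2' f3 pi =
      f1 pi - f1' pi + f2 pi - f2' pi + f3 pi.
    by have [_ _ _ _ [_ ->]] := switchedE f1 f1' f2 f2' f3 pi ha ha'.
  rewrite !FE; set v := _ + W3 pi; set dv := _ + dW3 pi.
  have wr phi psi : free_solution lambda phi psi -> phi pi * dv - psi pi * v = 0.
    move=> F; have := cancel _ _ F.
    rewrite (_ : 3 * a / 2 + b = pi - a); last by rewrite /b; field.
    rewrite (_ : 2 * a + b = pi - a / 2); last by rewrite /b; field.
    rewrite (_ : 5 * a / 2 + b = pi); last by rewrite /b; field.
    rewrite -(wronskian_increment pi F r1 r1') -(wronskian_increment pi F r2 r2') => H.
    by rewrite -[RHS]H /v /dv; ring.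
  (* The two resulting equations for v and dv have determinant
     C^2 + lambda S^2 = 1 at pi. *)
  have w1 := wr _ _ (cosine_free CS); have w2 := wr _ _ (sine_free CS).
  have sq := cosine_sine_sqr pi CS.
  split; rewrite -[LHS]mulr1 -sq.
    apply: (eq_by_multiple (c := S pi) w1); apply: (eq_by_multiple (c := - C pi) w2).
    by ring.
  apply: (eq_by_multiple (c := C pi) w1).
  apply: (eq_by_multiple (c := lambda * S pi) w2).
  by ring.
- move=> x /andP[x0 xpi] /and5P[n1 n2 n3 n4 n5].
  have far : x < 5 * a / 2 -> switched a W1 W1' W2 W2' W3 (x - a) = 0.
    move=> x5; have [-> //] := switchedE W1 W1' W2 W2' W3 (x - a) ha ha'.
    by clear -x5 ha ha'; lra.
  have [V0 V1 V1' V2 [V2' V3]] := switchedE W1 W1' W2 W2' W3 x ha ha'.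
  have [D0 D1 D1' D2 [D2' D3]] := switchedE (dd W1 g1) (dd W1' g1)
    (dd W2 g2) (dd W2' g2) (dd W3 g3) x ha ha'.
  have [x1|x1] := ltP x (3 * a / 2).
    by rewrite !q1_zero ?V0 ?D0//; [ring | apply: Or31; exact: ltW..].
  have {n1 V0 D0} x1 : 3 * a / 2 < x by rewrite lt_neqAle eq_sym n1.
  have [x2|x2] := ltP x (pi - a).
    have xI : 3 * a / 2 < x < pi - a by rewrite x1.
    rewrite !q1_first// V1// D1// /dd /g1 cE far; first by ring.
    by clear -x2 ha ha'; lra.
  have {n2 V1 D1} x2 : pi - a < x by rewrite lt_neqAle eq_sym n2.
  have [x3|x3] := ltP x (2 * a).
    have xI : pi - a < x < 2 * a by rewrite x2.
    rewrite !q1_zero ?V1' ?D1' ?/dd//; [ring | apply: Or32; rewrite !ltW//..].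
  have {n3 V1' D1'} x3 : 2 * a < x by rewrite lt_neqAle eq_sym n3.
  have [x4|x4] := ltP x (pi - a / 2).
    have xI : 2 * a < x < pi - a / 2 by rewrite x3.
    rewrite !q1_second// V2// D2// /dd /g2 kE sE far; first by ring.
    by clear -x4 ha ha'; lra.
  have {n4 V2 D2} x4 : pi - a / 2 < x by rewrite lt_neqAle eq_sym n4.
  have [x5|x5] := ltP x (5 * a / 2).
    have xI : pi - a / 2 < x < 5 * a / 2 by rewrite x4.
    rewrite !q1_zero ?V2' ?D2' ?/dd//; [ring | apply: Or33; rewrite !ltW//..].
  have {n5 V2' D2'} x5 : 5 * a / 2 < x by rewrite lt_neqAle eq_sym n5.
  have xI : 5 * a / 2 < x < pi by rewrite x5.
  have [_ E1 _ _ _] := switchedE W1 W1' W2 W2' W3 (x - a) ha ha'.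
  rewrite !q1_third// V3// D3// /dd /g3 hE E1; first by ring.
  by clear -x5 xpi ha ha'; apply/andP; split; lra.
Qed.

(** * Independence of the characteristic functions from alpha *)

Lemma q1_variation_support (R : realType) (a x : R) :
  pi / 3 <= a -> a < 2 * pi / 5 ->
  ~~ (3 * a / 2 < x < pi - a / 2) -> q1 a 1 x - q1 a 0 x = 0.
Proof.
move=> ha ha' /negP H; rewrite /q1 /q_family.
have -> : (3 * a / 2 < x < pi - a) = false.
  by apply/negbTE/negP => /andP[? ?]; apply: H; apply/andP; split; lra.
have -> : (2 * a < x < pi - a / 2) = false.
  by apply/negbTE/negP => /andP[? ?]; apply: H; apply/andP; split; lra.
by rewrite subrr.
Qed.

(** Where the potential varies with alpha, the delayed argument x - a lies in
    [0, 3a/2), so that there Y(x - a) = C(x - a) and V(x - a) = 0; this makes the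
    equation for the correction independent of alpha. *)
Lemma fundamental_solution_transfer (R : realType) (a : R) (alpha beta lambda : R[i])
    (Y : bool -> R -> R[i]) :
  pi / 3 <= a -> a < 2 * pi / 5 ->
  fundamental_solution a (q1 a alpha) lambda false Y ->
  exists2 Z, fundamental_solution a (q1 a beta) lambda false Z &
    forall j, Z j pi = Y j pi.
Proof.
move=> ha ha' [[d2y [AC0 AC1 ode]] init].
have [C [S CS]] := cosine_sine_exists lambda.
have [V [dV [d2V [ACV ACdV Vleft [Vpi dVpi] Vode]]]] := correction_exists ha ha' CS.
have y0 : Y false 0 = 1 by rewrite init.
have dy0 : Y true 0 = 0 by rewrite init.
have m0 : 0 <= 3 * a / 2 <= pi by apply/andP; split; lra.
have yC : forall x, 0 <= x <= 3 * a / 2 -> Y false x = C x.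
  apply: (initial_solution CS AC0 AC1 y0 dy0 m0).
  apply: filterS ode => x H; rewrite in_itv/= => /andP[x0 x1].
  have := H; rewrite in_itv/= x0 (lt_le_trans x1); last by case/andP: m0.
  move=> /(_ isT); rewrite q1_zero//; last by apply: Or31; exact: ltW.
  by rewrite mul0r addr0 mulNr => <-; rewrite opprK.
pose d := beta - alpha.
exists (fun j x => Y j x + d * (if j then dV x else V x)).
  split.
    exists (fun x => d2y x + d * d2V x); split.
    - exact: AC_add AC0 (ACV d).
    - exact: AC_add AC1 (ACdV d).
    - have ne : {ae @lebesgue_measure R, forall x, [&& x != 3 * a / 2, x != pi - a,
          x != 2 * a, x != pi - a / 2 & x != 5 * a / 2]}.
        apply: filterS3 (ae_neq (3 * a / 2)) (ae_neq (pi - a))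
          (filterI (ae_neq (2 * a)) (filterI (ae_neq (pi - a / 2)) (ae_neq (5 * a / 2)))).
        by move=> x -> -> [-> [-> ->]].
      apply: filterS2 ne ode => x xne H xI; have := H xI.
      move: xI; rewrite in_itv/= => xI E; rewrite Vode//.
      have -> : q1 a beta x = q1 a alpha x + d * (q1 a 1 x - q1 a 0 x).
        by rewrite q1_affine [in RHS]q1_affine /d; ring.
      have [near|/(q1_variation_support ha ha') D0] := boolP (3 * a / 2 < x < pi - a / 2).
        have xa : 0 <= x - a <= 3 * a / 2.
          by case/andP: near => ? ?; apply/andP; split; lra.
        have [Va _] : V (x - a) = 0 /\ dV (x - a) = 0.
          by apply: Vleft; case/andP: near => ? ?; lra.
        rewrite Va yC//; move: E; rewrite yC// => E.
        apply: (eq_by_multiple (c := 1) E); ring.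
      have q0 : q1 a 0 x = q1 a alpha x by rewrite (q1_affine _ alpha) D0 mulr0 addr0.
      rewrite D0 q0; apply: (eq_by_multiple (c := 1) E); ring.
  move=> j; have [V0 dV0] : V 0 = 0 /\ dV 0 = 0 by apply: Vleft; lra.
  by case: j; rewrite ?V0 ?dV0 mulr0 addr0 init.
by case; rewrite ?Vpi ?dVpi mulr0 addr0.
Qed.

(** The sets of values at pi from which the two characteristic functions choose
    are equal, by the transfer in both directions. *)
Lemma characteristic_function_q1 (R : realType) (a : R) (j : bool) (alpha beta : R[i]) :
  pi / 3 <= a -> a < 2 * pi / 5 ->
  characteristic_function a (q1 a alpha) true j =
  characteristic_function a (q1 a beta) true j.
Proof.
move=> ha ha'; apply/funext => lambda; rewrite /characteristic_function; congr xget.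
apply/seteqP; split => c [Y hY ->].
  by have [Z hZ ZY] := fundamental_solution_transfer beta ha ha' hY; exists Z.
by have [Z hZ ZY] := fundamental_solution_transfer alpha ha ha' hY; exists Z.
Qed.

(** * Square integrability, and two distinct members of the family *)

Lemma measurable_if_itv (R : realType) (p r : R) (f g : R -> R) :
  measurable_fun setT f -> measurable_fun setT g ->
  measurable_fun setT (fun x => if p < x < r then f x else g x).
Proof.
move=> mf mg; apply: measurable_fun_ifT => //.
by apply: measurable_and; exact: measurable_fun_ltr.
Qed.

Lemma q1_piecewise (R : realType) (a : R) (alpha : R[i]) :
  pi / 3 <= a -> a < 2 * pi / 5 -> q1 a alpha = fun x =>
    if 3 * a / 2 < x < pi - a then
      alpha * (envelope (pi - 5 * a / 2) (x - 3 * a / 2))%:C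
    else if 2 * a < x < pi - a / 2 then
      - alpha * (profile_tail (pi - 5 * a / 2) (x - 2 * a))%:C *
        (envelope_integral (pi - 5 * a / 2) (x - 2 * a))%:C
    else if 5 * a / 2 < x < pi then (profile (pi - 5 * a / 2) (x - 5 * a / 2))%:C
    else 0.
Proof.
move=> ha ha'; apply/funext => x.
case: ifPn => [xI|n1]; first exact: q1_first.
case: ifPn => [xI|n2]; first exact: q1_second.
case: ifPn => [xI|n3]; first exact: q1_third.
by rewrite /q1 /q_family (negbTE n1) (negbTE n2) (negbTE n3).
Qed.

(** |q|^2 is dominated by a continuous function, the sum of the squared moduli
    of its three expressions. *)
Lemma potential_q1 (R : realType) (a : R) (alpha : R[i]) :
  pi / 3 <= a -> a < 2 * pi / 5 -> potential a (q1 a alpha).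
Proof.
move=> ha ha'; have b0 : 0 < pi - 5 * a / 2 by lra.
split; last first.
  apply: aeW => x; rewrite in_itv/= => /andP[x0 xa].
  by apply: q1_zero => //; apply: Or31; lra.
pose b := pi - 5 * a / 2.
have ce : continuous (envelope b) by exact: envelope_continuous.
have cE : continuous (envelope_integral b).
  by move=> x; apply/differentiable_continuous/derivable1_diffP;
    have [] := envelope_integral_derive x b0.
have ck : continuous (profile_tail b).
  by move=> x; apply/differentiable_continuous/derivable1_diffP;
    have [] := profile_tail_derive x b0.
have ch : continuous (profile b).
  by move=> x; apply/differentiable_continuous/derivable1_diffP;
    have [] := profile_derive x b0.
have sh (f : R -> R) (p : R) : continuous f -> continuous (fun x => f (x - p)).
  move=> cf y; apply: (@continuous_comp _ _ _ (fun t => t - p)); last exact: cf.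
  by apply: cvgB; [exact: cvg_id | exact: cvg_cst].
have mZ (c : R) (f : R -> R) : continuous f -> continuous (fun x => c * f x).
  by move=> cf y; apply: (@cvgM R); [exact: cvg_cst | exact: cf].
have mM (f g : R -> R) : continuous f -> continuous g -> continuous (fun x => f x * g x).
  by move=> cf cg y; apply: (@cvgM R); [exact: cf | exact: cg].
pose F1 x := envelope b (x - 3 * a / 2).
pose F2 x := profile_tail b (x - 2 * a) * envelope_integral b (x - 2 * a).
pose F3 x := profile b (x - 5 * a / 2).
have c1 : continuous F1 by exact: sh.
have c2 : continuous F2 by apply: mM; exact: sh.
have c3 : continuous F3 by exact: sh.
have ReE x : Re (q1 a alpha x) =
    if 3 * a / 2 < x < pi - a then Re alpha * F1 x
    else if 2 * a < x < pi - a / 2 then - Re alpha * F2 x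
    else if 5 * a / 2 < x < pi then F3 x else 0.
  rewrite q1_piecewise//; case: ifP => _; first by rewrite cReM /= mulr0 subr0.
  case: ifP => _; first by rewrite !(cReM, cReN, cImM, cImN) /F2 /=; ring.
  by case: ifP.
have ImE x : Im (q1 a alpha x) =
    if 3 * a / 2 < x < pi - a then Im alpha * F1 x
    else if 2 * a < x < pi - a / 2 then - Im alpha * F2 x
    else 0.
  rewrite q1_piecewise//; case: ifP => _; first by rewrite cImM /= mulr0 add0r.
  case: ifP => _; first by rewrite !(cReM, cReN, cImM, cImN) /F2 /=; ring.
  by case: ifP.
have mRe : measurable_fun setT (fun x => Re (q1 a alpha x)).
  under eq_fun do rewrite ReE.
  apply: measurable_if_itv; first exact: continuous_measurable (mZ _ _ c1).
  apply: measurable_if_itv; first exact: continuous_measurable (mZ _ _ c2).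
  by apply: measurable_if_itv; first exact: continuous_measurable c3.
have mIm : measurable_fun setT (fun x => Im (q1 a alpha x)).
  under eq_fun do rewrite ImE.
  apply: measurable_if_itv; first exact: continuous_measurable (mZ _ _ c1).
  by apply: measurable_if_itv; first exact: continuous_measurable (mZ _ _ c2).
split; [exact: measurable_funTS | exact: measurable_funTS |].
pose c := Re alpha ^+ 2 + Im alpha ^+ 2.
pose G x := c * (F1 x * F1 x) + (c * (F2 x * F2 x) + F3 x * F3 x).
have cG : continuous G.
  have h1 := mZ c _ (mM _ _ c1 c1); have h2 := mZ c _ (mM _ _ c2 c2).
  by move=> y; exact: (cvgD (h1 y) (cvgD (h2 y) (mM _ _ c3 c3 y))).
have /integrableP[mG] := continuous_integrable 0 pi cG.
apply: le_lt_trans; apply: (@le_trans _ _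
    (\int[@lebesgue_measure R]_(x in `]0%R, (pi : R)[) `|(G x)%:E|)%E).
  apply: ge0_le_integral => //.
  - by move=> x _; rewrite lee_fin addr_ge0 ?sqr_ge0.
  - apply/measurable_EFinP/measurable_funTS; apply: measurable_funD;
      exact: measurable_funX.
  - by apply: measurableT_comp => //; apply/measurable_EFinP; exact: continuous_measurable.
  move=> x _; rewrite abse_EFin lee_fin.
  apply: le_trans (ler_norm _); rewrite ReE ImE /G /c.
  have c0 : 0 <= c by rewrite addr_ge0 ?sqr_ge0.
  rewrite -/c; move: (F1 x) (F2 x) (F3 x) => f1 f2 f3.
  have d1 : 0 <= c * (f1 * f1) by rewrite mulr_ge0// -expr2 sqr_ge0.
  have d2 : 0 <= c * (f2 * f2) by rewrite mulr_ge0// -expr2 sqr_ge0.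
  have d3 : 0 <= f3 * f3 by rewrite -expr2 sqr_ge0.
  case: ifP => _; first by rewrite !exprMn -mulrDl -/c expr2; lra.
  case: ifP => _; first by rewrite !exprMn !sqrrN -mulrDl -/c expr2; lra.
  by case: ifP => _; rewrite !expr2 !mulr0; lra.
apply: ge0_subset_integral => //.
- by move: mG => /measurable_EFinP mG; apply: measurableT_comp => //; exact/measurable_EFinP.
- exact: subset_itv_oo_cc.
Qed.

(** On the first quarter of the first window both cosines of e1 have arguments in
    (0, pi/2), so q_1 = e1 > 0 = q_0 there. *)
Lemma q1_0_1_not_ae_eq (R : realType) (a : R) :
  pi / 3 <= a -> a < 2 * pi / 5 ->
  ~ {ae @lebesgue_measure R, forall x, x \in `]0, pi[ -> q1 a 0 x = q1 a 1 x}.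
Proof.
move=> ha ha' [N [mN N0 sub]].
pose b := pi - 5 * a / 2; have b0 : 0 < b by rewrite /b; lra.
pose J : set R := `]3 * a / 2, 3 * a / 2 + b / 4[%classic.
have sJ : J `<=` N.
  move=> x; rewrite /J /= in_itv/= => /andP[x1 x2]; apply: sub => /= H.
  have xI : 3 * a / 2 < x < pi - a by apply/andP; split => //; move: x2; rewrite /b; lra.
  have : q1 a 0 x = q1 a 1 x by apply: H; rewrite in_itv/=; apply/andP; split; case/andP: xI; lra.
  rewrite !q1_first// mul0r mul1r => /(congr1 (@complex.Re R)) /= E.
  have pi0 := pi_gt0 R.
  have u0 : 0 < x - 3 * a / 2 by lra.
  have u1 : x - 3 * a / 2 < b / 4 by lra.
  have s0 : 0 < pi / b by rewrite divr_gt0.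
  have t1 : pi / b * (x - 3 * a / 2) < pi / 4.
    rewrite (_ : pi / 4 = pi / b * (b / 4)); last by field; rewrite gt_eqF.
    by rewrite ltr_pM2l.
  have t0 : 0 < pi / b * (x - 3 * a / 2) by rewrite mulr_gt0.
  have : 0 < envelope b (x - 3 * a / 2).
    rewrite /envelope.
    rewrite (_ : 2 * pi / b * (x - 3 * a / 2) = 2 * (pi / b * (x - 3 * a / 2))); last by ring.
    move: (pi / b * (x - 3 * a / 2)) t0 t1 => t t0 t1.
    by rewrite addr_gt0//; apply: cos_gt0_pihalf; apply/andP; split; lra.
  by rewrite -E ltxx.
have : (@lebesgue_measure R J <= 0)%E.
  rewrite -N0; apply: le_measure; rewrite ?inE; [|exact: mN|exact: sJ].
  exact: measurable_itv.
rewrite /J lebesgue_measure_itv/= lte_fin ltrDl divr_gt0//.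
by rewrite -EFinB lee_fin; lra.
Qed.

Theorem mainTheorem3 (R : realType) (a : R)
    (ha : pi / 3 <= a) (ha' : a < 2 * pi / 5) :
  [/\ (forall alpha : R[i], potential a (q1 a alpha)),
      (forall (j : bool) (alpha beta : R[i]),
         spectrum a (q1 a alpha) true j = spectrum a (q1 a beta) true j) &
      ~ (forall q r : R -> R[i], potential a q -> potential a r ->
           (forall j : bool, spectrum a q true j = spectrum a r true j) ->
           {ae @lebesgue_measure R, forall x, x \in `]0, pi[ -> q x = r x})].
Proof.
have iso (j : bool) (alpha beta : R[i]) :
    spectrum a (q1 a alpha) true j = spectrum a (q1 a beta) true j.
  by rewrite /spectrum (characteristic_function_q1 j alpha beta).
split=> [alpha|//|H]; first exact: potential_q1.
by apply: (q1_0_1_not_ae_eq ha ha'); apply: H => [||j]; first exact: potential_q1;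
  [exact: potential_q1 | exact: iso].
Qed.
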